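(* Let $n\ge 2$ and let $v=(v_1,\dots,v_n)\in\mathsf H_+$. Then the upper and lower directional entropies $\overline{\mathsf E}_n(v)$ and $\underline{\mathsf E}_n(v)$ of $O_n^\times$ in the direction $v$ coincide, and their common value is $$\mathsf E_n(v)=\sum_{i=1}^{n-1}(n-i)\,v_i .$$
   Context: $\mathsf H_+=\{v=(v_1,\dots,v_n)\in\mathbb R^n:\ \sum_i v_i=0,\ v_1>\dots>v_n\}$. Let $\mathcal K_n$ be the set of pairs $(K,\sigma)$ where $K$ is a totally real number field of degree $n$ and $\sigma=(\sigma_1,\dots,\sigma_n)$ is an ordering of the $n$ distinct field embeddings $K\to\mathbb R$. Pairs $(K,\sigma)$ and $(K',\sigma')$ are identified if there is a field isomorphism $\varphi:K\to K'$ with $\sigma'_i\circ\varphi=\sigma_i$ for all $i$ (so $\mathcal K_n$ contains one representative of each isomorphism class of pairs). Let $O_K^\times$ be the unit group of the ring of integers of $K$, and let $$O_n^\times=\bigsqcup_{(K,\sigma)\in\mathcal K_n}O_K^\times$$ (disjoint union; the component indexed by $(K,\sigma)$ is denoted $(O_K^\times,\sigma)$). For $u\in(O_K^\times,\sigma)$ put $\Lambda(u)=(\log|\sigma_1(u)|,\dots,\log|\sigma_n(u)|)\in\mathbb R^n$. Fix a norm $\|\cdot\|$ on $\mathbb R^n$. For $\varepsilon>0$, $T>0$ let $$N_\varepsilon(T,v)=\#\{u\in O_n^\times:\ \|\Lambda(u)\|\le T,\ \|\Lambda(u)-\mathbb R_+v\|<\varepsilon\},$$ where $\|x-\mathbb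 R_+v\|$ is the distance from $x$ to the ray $\mathbb R_+v$. Define $$\overline{\mathsf E}_n(v)=\|v\|\lim_{\varepsilon\to0}\limsup_{T\to\infty}\frac1T\log N_\varepsilon(T,v),\qquad \underline{\mathsf E}_n(v)=\|v\|\lim_{\varepsilon\to0}\liminf_{T\to\infty}\frac1T\log N_\varepsilon(T,v)$$ (with $\log 0=-\infty$). These are independent of the norm; when they coincide the common value is denoted $\mathsf E_n(v)$.
   Formalization: The count N_ε(T,v) here omits the units u = 1 and u = −1 of each component: they have Λ(u) = 0 and occur in each of the infinitely many fields, so counting them makes N_ε(T,v) infinite and both entropies +∞ for every v. *)

(* Defs.v *)
From HB Require Import structures.
From mathcomp Require Import all_boot all_order all_algebra all_field.
From mathcomp Require Import complex.
From mathcomp Require Import all_classical all_reals all_analysis.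
Set Implicit Arguments.
Unset Strict Implicit.
Unset Printing Implicit Defensive.
Import Order.TTheory GRing.Theory Num.Theory.
Import numFieldNormedType.Exports.
Local Open Scope classical_set_scope.
Local Open Scope ring_scope.

Definition totally_real (R : realType) (K : fieldExtType rat) : Prop :=
  forall (tau : {rmorphism K -> complex R}) (x : K), complex.Im (tau x) = 0.

(* Embeddings are compared extensionally ([=1]), two [{rmorphism _ -> _}]
   records with the same underlying map being the same embedding. *)
Record marked_field (R : realType) (n : nat) : Type := MarkedField {
  mf_field : fieldExtType rat;
  mf_degree : \dim {: mf_field} = n;
  mf_totally_real : totally_real R mf_field;
  mf_emb : 'I_n -> {rmorphism mf_field -> R};
  mf_emb_inj : forall i j, mf_emb i =1 mf_emb j -> i = j;
  mf_emb_surj : forall tau : {rmorphism mf_field -> R},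
    exists i, mf_emb i =1 tau
}.

Definition mf_isom (R : realType) (n : nat) (M M' : marked_field R n) : Prop :=
  exists2 phi : {rmorphism mf_field M -> mf_field M'}, bijective phi &
    forall i x, mf_emb M' i (phi x) = mf_emb M i x.

(* [K] lists the pairs up to isomorphism, one representative for each class.
   The index type is a parameter because universe constraints prevent
   [marked_field R n] from being an [eqType], hence from being quotiented;
   [representatives_exist] shows that such a [K] exists. *)
Definition representatives (R : realType) (n : nat) (I : Type)
    (K : I -> marked_field R n) : Prop :=
  forall M, exists! i, mf_isom M (K i).

Section RepresentativesExist.
Variables (R : realType) (n : nat).
Implicit Types M : marked_field R n.

Let image M : set 'rV[R]_n := range (fun x => \row_i mf_emb M i x).

Let mf_emb_eq M x y : (forall i, mf_emb M i x = mf_emb M i y) -> x = y.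
Proof.
have n_gt0 : (0 < n)%N by rewrite -(mf_degree M) adim_gt0.
by move=> /(_ (Ordinal n_gt0)); apply: fmorph_inj.
Qed.

Let isom_image M M' : mf_isom M M' -> image M = image M'.
Proof.
case=> phi [psi phiK psiK] phiE; apply/seteqP; split=> _ [x _ <-].
  by exists (phi x) => //; apply/rowP=> i; rewrite !mxE phiE.
by exists (psi x) => //; apply/rowP=> i; rewrite !mxE -phiE psiK.
Qed.

Let image_isom M M' : image M = image M' -> mf_isom M M'.
Proof.
move=> eqMM'.
have transfer (N N' : marked_field R n) : image N = image N' -> forall x,
    {y | forall i, mf_emb N' i y = mf_emb N i x}.
  move=> eqNN' x; apply: cid.
  have [y _ yx] : image N' (\row_i mf_emb N i x) by rewrite -eqNN'; exists x.
  by exists y => i; move/rowP/(_ i): yx; rewrite !mxE.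
pose phi x := sval (transfer M M' eqMM' x).
pose psi y := sval (transfer M' M (esym eqMM') y).
have phiE x i : mf_emb M' i (phi x) = mf_emb M i x.
  exact: (svalP (transfer M M' eqMM' x)).
have psiE y i : mf_emb M i (psi y) = mf_emb M' i y.
  exact: (svalP (transfer M' M (esym eqMM') y)).
have phiB : zmod_morphism phi.
  by move=> x y; apply: mf_emb_eq => i; rewrite rmorphB /= !phiE rmorphB.
have phiM : monoid_morphism phi.
  split=> [|x y]; apply: mf_emb_eq => i; first by rewrite phiE !rmorph1.
  by rewrite rmorphM /= !phiE rmorphM.
pose phi_add := GRing.isZmodMorphism.Build _ _ phi phiB.
pose phi_mul := GRing.isMonoidMorphism.Build _ _ phi phiM.
pose phi_rm : {rmorphism mf_field M -> mf_field M'} :=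
  HB.pack phi phi_add phi_mul.
exists phi_rm => [|i x]; last exact: phiE.
by exists psi => x; apply: mf_emb_eq => i; rewrite ?psiE phiE ?psiE.
Qed.

Lemma representatives_exist :
  exists (I : choiceType) (K : I -> marked_field R n), representatives K.
Proof.
pose I : choiceType := {S : set 'rV[R]_n | `[< exists M, image M = S >]}.
have repP (k : I) : {M | image M = val k} by apply: cid; exact/asboolP/(valP k).
exists I, (fun k => sval (repP k)) => M.
have imM : `[< exists N, image N = image M >] by apply/asboolP; exists M.
exists (Sub (image M) imM); split=> [|k /isom_image eqk].
  by apply: image_isom; rewrite (svalP (repP _)) SubK.
by apply: val_inj; rewrite SubK eqk (svalP (repP k)).
Qed.

End RepresentativesExist.

Definition algebraic_integer (K : fieldExtType rat) : set K :=
  [set x | integralOver (intr : int -> K) x].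

Definition unit_group (K : fieldExtType rat) : set K :=
  [set u | algebraic_integer u /\
           exists2 w, algebraic_integer w & u * w = 1].

Record is_norm (R : realType) (V : lmodType R) (nrm : V -> R) : Prop := IsNorm {
  is_norm_ge0 : forall x, 0 <= nrm x;
  is_norm_eq0 : forall x, nrm x = 0 -> x = 0;
  is_normZ : forall a x, nrm (a *: x) = `|a| * nrm x;
  is_normD : forall x y, nrm (x + y) <= nrm x + nrm y
}.

Definition dist_ray (R : realType) (V : lmodType R) (nrm : V -> R) (v x : V) :
  R := inf [set nrm (x - t *: v) | t in [set t : R | 0 <= t]].

Definition weyl_chamber (R : realType) (n : nat) : set 'rV[R]_n :=
  [set v | \sum_i v ord0 i = 0 /\
           forall i j : 'I_n, (i < j)%N -> v ord0 j < v ord0 i].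

Section Entropy.
Variables (R : realType) (n : nat) (I : choiceType).
Variables (K : I -> marked_field R n) (nrm : 'rV[R]_n -> R).
Implicit Types (v : 'rV[R]_n) (eps T : R).

Definition unit_union : set {i : I & mf_field (K i)} :=
  [set u | unit_group (projT2 u)].

Definition log_embedding (u : {i : I & mf_field (K i)}) : 'rV[R]_n :=
  \row_j ln `|mf_emb (K (projT1 u)) j (projT2 u)|.

Definition torsion_unit (u : {i : I & mf_field (K i)}) : Prop :=
  projT2 u = 1 \/ projT2 u = -1.

(* The units [1] and [-1] are left out: each of them occurs once in every one
   of the infinitely many fields [K i] and has logarithmic embedding [0], so
   that counting them would make [unit_count eps T v] equal to [+oo] whatever
   [eps], [T] and [v] are. *)
Definition unit_count eps T v : \bar R :=
  counting [set u | [/\ unit_union u, ~ torsion_unit u,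
    nrm (log_embedding u) <= T & dist_ray nrm v (log_embedding u) < eps]].

(* [lne 0 = -oo]; the outer limits exist in [\bar R] because [unit_count] is
   nondecreasing in [eps]. *)
Definition upper_entropy v : \bar R :=
  ((nrm v)%:E *
   lim (limf_esup (fun T : R => (T^-1)%:E * lne (unit_count eps T v))
          (pinfty_nbhs R) @[eps --> (0 : R)^'+]))%E.

Definition lower_entropy v : \bar R :=
  ((nrm v)%:E *
   lim (limf_einf (fun T : R => (T^-1)%:E * lne (unit_count eps T v))
          (pinfty_nbhs R) @[eps --> (0 : R)^'+]))%E.

End Entropy.

(* Main.v *)
Require Import Defs.
From HB Require Import structures.
From mathcomp Require Import all_boot all_order all_algebra all_field.
From mathcomp Require Import complex.
From mathcomp Require Import all_classical all_reals all_analysis.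
From mathcomp Require Import ring lra zify.
Set Implicit Arguments.
Unset Strict Implicit.
Unset Printing Implicit Defensive.
Import Order.TTheory GRing.Theory Num.Theory.
Import numFieldNormedType.Exports.
Local Open Scope classical_set_scope.
Local Open Scope ring_scope.

(** Put [s_k = v_1 + ... + v_k], so that [s_n = 0], [s_k > 0] for [0 < k < n],
    and [s_1 + ... + s_n] is the claimed value [E].  A unit [u] near [t v] has
    conjugates of absolute values about [exp (t v_j)], and the polynomial with
    these roots has its coefficients of index [n - k] of size at most about
    [exp (t s_k)].  Conversely, a positive proportion of the coefficient
    vectors of these sizes comes from such units.  Counting integral
    coefficient vectors with [t = T / |v|] gives [exp (T E / |v|)] up to
    constant factors, so that the upper and lower growth rates agree for every
    small [eps].

    Upper bound ([unit_count_le]).  The counted units must be recovered from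
    their polynomials.  A nonzero algebraic integer has a conjugate of absolute
    value at least 1 ([algebraic_integer_conjugate_ge1]); applied to [u^2 - 1],
    this shows that a unit whose logarithms are all small is 1 or -1
    ([small_log_torsion]).  If two coordinates of the logarithm of a counted
    unit were in the wrong order, the unit would lie near [t v] with [t] of the
    order of [eps], and its logarithms would be small.  So for [eps] small,
    counted units have conjugates of strictly decreasing absolute values
    ([counted_decreasing]).  They therefore generate their fields, have an
    integral polynomial of degree [n] which determines the ordered conjugates
    ([eq_decreasing_roots]), and these determine the pair of the field and its
    marking ([conjugates_isom]).

    Lower bound ([unit_count_ge]).  Take polynomials with coefficients
    [(-1)^k m_k], where [m_0 = m_n = 1] and [m_k] runs over the integers of a
    class modulo 4 in an interval [exp (t s_k), (1 + delta) exp (t s_k)].  At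
    the points [exp (t v_k - eta)] and [exp (t v_k + eta)] a single monomial
    dominates, and the sign changes between them; so all the roots are real and
    lie where they should ([alt_poly_roots]).  The classes modulo 4 are those of
    [(X - 1)^n + 2 h] with [h(1)] odd, which makes the polynomial Eisenstein at
    2 after the substitution of [X + 1] for [X] ([alt_poly_irreducible]).  A
    root generates a totally real field of degree [n]
    ([marked_field_of_roots]) in which it is a unit. *)

(** * Polynomials and their integral roots *)

Lemma map_poly_intr (A B : nzRingType) (f : {rmorphism A -> B})
    (p : {poly int}) :
  map_poly f (map_poly intr p) = map_poly intr p.
Proof.
rewrite -map_poly_comp; apply: eq_map_poly => a.
by rewrite -[LHS]/(f a%:~R) rmorph_int.
Qed.

Lemma size_prod_XsubC_ord (A : nzRingType) n (x : 'I_n -> A) :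
  size (\prod_j ('X - (x j)%:P)) = n.+1.
Proof. by rewrite size_prod_XsubC /index_enum -enumT size_enum_ord. Qed.

Lemma root_prod_XsubC_ord (A : idomainType) n (x : 'I_n -> A) a :
  root (\prod_j ('X - (x j)%:P)) a = (a \in codom x).
Proof.
rewrite -(big_map x xpredT (fun b => 'X - b%:P)) root_prod_XsubC.
by apply/mapP/mapP => -[j _ ->]; exists j; rewrite ?mem_index_enum ?mem_enum.
Qed.

Lemma decreasing_injective (A : realDomainType) n (x : 'I_n -> A) :
  (forall i j : 'I_n, (i < j)%N -> x j < x i) -> injective x.
Proof.
move=> x_dec i j; case: (ltngtP i j) => [/x_dec|/x_dec|/val_inj//] + xij.
  by rewrite xij ltxx.
by rewrite xij ltxx.
Qed.

(** Gauss's lemma: the leading coefficients of an integral cofactor pair of a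
    monic polynomial are inverse to each other, so the rational scalar that
    separates a factor from its integral multiple is itself an integer. *)
Lemma monic_dvdp_rat_int (p : {poly rat}) (q : {poly int}) :
  p \is monic -> q \is monic -> p %| map_poly intr q ->
  exists2 r : {poly int}, r \is monic & p = map_poly intr r.
Proof.
move=> /monicP mp /monicP mq /dvdpP_rat_int[p1 [a a0 pE] [r qE]].
have lead1 : lead_coef p1 * lead_coef r = 1.
  by rewrite -lead_coefM -qE mq.
have leada : a * (lead_coef p1)%:~R = 1.
  have := congr1 lead_coef pE; rewrite mp lead_coefZ lead_coef_map_inj //.
  exact: intr_inj.
have aE : a = (lead_coef r)%:~R.
  rewrite -[LHS]mulr1 -[X in a * X](rmorph1 (intr : int -> rat)) -lead1.
  by rewrite rmorphM mulrA leada mul1r.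
exists (lead_coef r *: p1); first by apply/monicP; rewrite lead_coefZ mulrC.
by rewrite pE aE -map_polyZ.
Qed.

(** The minimal polynomial over the base field, pulled back to a polynomial
    with coefficients in that field itself, where divisibility can be compared
    with integral polynomials. *)
Lemma minPoly1P (F : fieldType) (L : fieldExtType F) (x : L) :
  exists p : {poly F}, [/\ p \is monic,
    minPoly 1%AS x = map_poly (in_alg L) p &
    forall q, root (map_poly (in_alg L) q) x -> p %| q].
Proof.
have /polyOver1P[p pE] := minPolyOver 1%AS x; exists p; split=> // [|q qx0].
  by rewrite -(map_monic (in_alg L)) -pE monic_minPoly.
rewrite -(dvdp_map (in_alg L)) -pE minPoly_dvdp //.
by apply/polyOver1P; exists q.
Qed.

Lemma minPoly_algebraic_integer (K : fieldExtType rat) (x : K) :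
  algebraic_integer x ->
  exists2 p : {poly int}, p \is monic & minPoly 1%AS x = map_poly intr p.
Proof.
case=> q mq qx0; have [p [mp pE p_dvd]] := minPoly1P x.
have [|r mr rE] := monic_dvdp_rat_int mp mq.
  by apply: p_dvd; rewrite (map_poly_intr (in_alg K)).
by exists r; rewrite // pE rE (map_poly_intr (in_alg K)).
Qed.

(** * Embeddings of number fields *)
Section Embeddings.
Variables (K : fieldExtType rat) (F : fieldType).
Implicit Types (sigma tau : {rmorphism K -> F}) (E : {subfield K}).

Lemma rmorph_algQ sigma tau (a : rat) : sigma a%:A = tau a%:A.
Proof.
rewrite -[a%:A]/(in_alg K a).
by rewrite -[LHS]/((sigma \o in_alg K) a) -[RHS]/((tau \o in_alg K) a)
  !fmorph_eq_rat.
Qed.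

Lemma eq_rmorph_adjoin sigma tau E x :
  {in E, sigma =1 tau} -> sigma x = tau x -> {in <<E; x>>%VS, sigma =1 tau}.
Proof.
move=> eqE eqx _ /Fadjoin_polyP[p pE ->].
rewrite -!horner_map eqx; congr (_.[_]); apply/polyP => i.
by rewrite !coef_map; apply: eqE; exact: (polyOverP pE).
Qed.

Lemma eq_rmorph_adjoin1 sigma tau x :
  sigma x = tau x -> {in <<1; x>>%VS, sigma =1 tau}.
Proof.
apply: eq_rmorph_adjoin => _ /vlineP[a ->]; exact: rmorph_algQ.
Qed.

(** If [K = E(theta)] with [E = Q(x)], two embeddings with the same value at [x]
    agree on [E], hence transport the minimal polynomial of [theta] over [E] to
    the same polynomial, and they differ by the root of it that [theta] is sent
    to.  So a value at [x] is taken by at most [K : E] embeddings, and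
    [K : Q] embeddings take at least [E : Q] values. *)
Lemma card_conjugates m (sigma : 'I_m -> {rmorphism K -> F}) x :
  (forall i j, sigma i =1 sigma j -> i = j) -> m = \dim {:K} ->
  (adjoin_degree 1%AS x <= size (undup (codom (fun j => sigma j x))))%N.
Proof.
move=> sigma_inj mE; set s := undup _.
pose E := <<1; x>>%AS.
(* The power of [y] that is separable has an exponent whose prime divisors are
   all equal to the characteristic, so this exponent is 1. *)
have sepE : separable E fullv.
  apply/separableP => y _.
  have [k /andP[/andP[k_gt0 kP]]] := separable_exponent_pchar E y.
  have [k_le1 | k_gt1] := leqP k 1.
    by have /eqP-> : k == 1%N by rewrite eqn_leq k_le1.
  have /(allP kP) : pdiv k \in primes k.
    by rewrite mem_primes pdiv_prime // k_gt0 pdiv_dvd.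
  by rewrite pchar_lalg pchar_num.
have [theta thetaE] : exists theta, fullv = <<E; theta>>%VS :> {vspace K}.
  by exists (separable_generator E fullv); apply: eq_adjoin_separable_generator;
    rewrite ?subvf.
pose e := adjoin_degree E theta.
have fibre a : (#|[set j | sigma j x == a]%SET| <= e)%N.
  have [->|[j0]] := set_0Vmem [set j | sigma j x == a]%SET;
    first by rewrite cards0.
  rewrite inE => /eqP j0a; pose p := map_poly (sigma j0) (minPoly E theta).
  have p0 : p != 0 by rewrite map_poly_eq0 monic_neq0 // monic_minPoly.
  have eqE j : sigma j x = a -> {in E, sigma j =1 sigma j0}.
    by move=> ja; apply: eq_rmorph_adjoin1; rewrite ja j0a.
  rewrite -ltnS /e -(size_minPoly E theta) -(size_map_poly (sigma j0)) -/p.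
  rewrite cardE -(size_map (fun j => sigma j theta)).
  apply: max_poly_roots => //.
    apply/allP => b /mapP[j]; rewrite mem_enum inE => /eqP ja ->.
    suff -> : p = map_poly (sigma j) (minPoly E theta).
      by rewrite fmorph_root root_minPoly.
    apply/polyP => i; rewrite !coef_map; apply/esym/(eqE j ja).
    exact: (polyOverP (minPolyOver _ _)).
  rewrite map_inj_in_uniq ?enum_uniq // => j k.
  rewrite !mem_enum !inE => /eqP ja /eqP ka jk; apply: sigma_inj => y.
  apply: (@eq_rmorph_adjoin _ _ E theta) => //; last by rewrite -thetaE memvf.
  by move=> z zE; rewrite (eqE j) // (eqE k).
have m_le : (m <= size s * e)%N.
  have -> : m = (\sum_(j < m) \sum_(a <- s) (sigma j x == a))%N.
    rewrite -[LHS]card_ord -sum1_card; apply: eq_bigr => j _.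
    under eq_bigr => a _ do rewrite eq_sym -[nat_of_bool _]mulnbl muln1.
    rewrite -big_mkcond sum1_count count_uniq_mem ?undup_uniq //.
    by rewrite mem_undup codom_f.
  rewrite exchange_big /= -sum1_size big_distrl /=.
  apply: leq_sum => a _; rewrite mul1n; apply: leq_trans (fibre a).
  rewrite -sum1_card [leqRHS]big_mkcond; apply: leq_sum => j _.
  by rewrite inE; case: eqP.
move: m_le; rewrite mE thetaE dim_Fadjoin -/e [(e * _)%N]mulnC leq_pmul2r //.
by rewrite dim_Fadjoin dimv1 muln1.
Qed.

(** The values of the embeddings at [x] are roots of the minimal polynomial, and
    [card_conjugates] says that there are enough of them to be all its roots. *)
Lemma minPoly_prod_conjugates m (sigma : 'I_m -> {rmorphism K -> F}) i0 x :
  (forall i j, sigma i =1 sigma j -> i = j) -> m = \dim {:K} ->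
  map_poly (sigma i0) (minPoly 1%AS x) =
  \prod_(a <- undup (codom (fun j => sigma j x))) ('X - a%:P).
Proof.
move=> sigma_inj mE; set s := undup _; set p := map_poly _ _.
have mp : p \is monic by rewrite map_monic monic_minPoly.
have sz_p : size p = (adjoin_degree 1%AS x).+1.
  by rewrite size_map_poly size_minPoly.
have roots_p : all (root p) s.
  apply/allP => b; rewrite mem_undup => /codomP[j ->].
  suff -> : p = map_poly (sigma j) (minPoly 1%AS x).
    by rewrite fmorph_root root_minPoly.
  apply/polyP => i; rewrite !coef_map.
  have /vlineP[a ->] := polyOverP (minPolyOver 1%AS x) i.
  exact: rmorph_algQ.
have uniq_s : uniq s by exact: undup_uniq.
have sz_s : size p = (size s).+1.
  apply/eqP; rewrite eqn_leq max_poly_roots ?monic_neq0 // andbT sz_p ltnS.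
  exact: card_conjugates.
by rewrite [LHS](all_roots_prod_XsubC sz_s) ?uniq_rootsE // (monicP mp) scale1r.
Qed.

End Embeddings.

Section AdjoinMorphism.
Variables (K : fieldExtType rat) (F : fieldType) (iota : {rmorphism rat -> F}).
Variables (z : K) (x : F).
Hypothesis z_gen : <<1; z>>%VS = fullv.
Hypothesis root_zx :
  forall q, root (map_poly (in_alg K) q) z -> root (map_poly iota q) x.

(** A morphism out of [Q(z)] is evaluation at [x] of any polynomial expression
    in [z]; [root_zx] makes this independent of the expression. *)
Lemma adjoin_rmorphism : exists phi : {rmorphism K -> F}, phi z = x.
Proof.
have ex_poly y : {q : {poly rat} | y = (map_poly (in_alg K) q).[z]}.
  by apply/cid/Fadjoin1_polyP; rewrite z_gen memvf.
pose phi y := (map_poly iota (sval (ex_poly y))).[x].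
have phiE q : phi (map_poly (in_alg K) q).[z] = (map_poly iota q).[x].
  apply/eqP; rewrite -subr_eq0 -hornerN -hornerD -!rmorphB.
  apply/root_zx/rootP; rewrite rmorphB hornerD hornerN.
  by rewrite -(svalP (ex_poly _)) subrr.
have phiB : zmod_morphism phi.
  move=> a b; rewrite [a](svalP (ex_poly a)) [b](svalP (ex_poly b)).
  by rewrite -hornerN -hornerD -rmorphB !phiE rmorphB hornerD hornerN.
have phiM : monoid_morphism phi.
  split=> [|a b].
    have -> : 1 = (map_poly (in_alg K) 1).[z] by rewrite rmorph1 hornerC.
    by rewrite phiE rmorph1 hornerC.
  rewrite [a](svalP (ex_poly a)) [b](svalP (ex_poly b)).
  by rewrite -hornerM -rmorphM !phiE rmorphM hornerM.
pose phi_add := GRing.isZmodMorphism.Build _ _ phi phiB.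
pose phi_mul := GRing.isMonoidMorphism.Build _ _ phi phiM.
pose phi_rm : {rmorphism K -> F} := HB.pack phi phi_add phi_mul.
exists phi_rm; rewrite -[LHS]/(phi z).
have {1}-> : z = (map_poly (in_alg K) 'X).[z] by rewrite map_polyX hornerX.
by rewrite phiE map_polyX hornerX.
Qed.

End AdjoinMorphism.

(** * Marked totally real fields *)
Section MarkedFieldTheory.
Variables (R : realType) (n : nat).
Implicit Types M : marked_field R n.

Lemma marked_field_gt0 M : (0 < n)%N.
Proof. by rewrite -(mf_degree M) adim_gt0. Qed.

Lemma algebraic_integer_prod_conjugates M (x : mf_field M) :
  algebraic_integer x ->
  exists2 p : {poly int}, p \is monic & map_poly intr p =
    \prod_(a <- undup (codom (fun j => mf_emb M j x))) ('X - a%:P).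
Proof.
move=> /minPoly_algebraic_integer[p mp pE]; exists p => //.
have i0 : 'I_n := Ordinal (marked_field_gt0 M).
rewrite -(minPoly_prod_conjugates i0 x (@mf_emb_inj _ _ M)) ?mf_degree //.
by rewrite pE map_poly_intr.
Qed.

(** The constant coefficient of the minimal polynomial is a nonzero integer, and
    it is up to sign the product of the distinct conjugates. *)
Lemma algebraic_integer_conjugate_ge1 M (x : mf_field M) :
  algebraic_integer x -> x != 0 -> exists j, 1 <= `|mf_emb M j x|.
Proof.
move=> /algebraic_integer_prod_conjugates[p _ pE] x0.
apply: contrapT => /forallNP small.
have small_s a : a \in undup (codom (fun j => mf_emb M j x)) -> 0 < `|a| < 1.
  rewrite mem_undup => /codomP[j ->]; rewrite normr_gt0 fmorph_eq0 x0 /=.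
  by rewrite ltNge; apply/negP/small.
have := congr1 (fun q : {poly R} => `|q.[0]|) pE.
rewrite /= horner_prod normr_prod.
have : undup (codom (fun j => mf_emb M j x)) != [::].
  apply/eqP => /(congr1 (fun s =>
    mf_emb M (Ordinal (marked_field_gt0 M)) x \in s)).
  by rewrite mem_undup codom_f.
move: small_s; case: (undup _) => // a s small_s _.
rewrite horner_coef0 coef_map /= => p0E.
have prod_s : 0 < \prod_(b <- s) `|('X - b%:P).[0]| <= 1.
  rewrite big_seq; apply: (big_ind (fun y : R => 0 < y <= 1)).
  - by rewrite ltr01 lexx.
  - by move=> y z /andP[y0 y1] /andP[z0 z1]; rewrite mulr_gt0 ?mulr_ile1 // ltW.
  - move=> b bs; rewrite !hornerE normrN.
    by have /andP[-> /ltW->] := small_s b (mem_behead (s := _ :: _) bs).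
have /andP[a0 a1] := small_s a (mem_head _ _).
move: p0E; rewrite big_cons !hornerE normrN => p0E.
have : 0 < `|(p`_0)%:~R : R| < 1.
  case/andP: prod_s => s0 s1; rewrite p0E mulr_gt0 //=.
  by apply: le_lt_trans a1; rewrite ger_pMr.
by rewrite -intr_norm ltr0z ltrz1; case: (p`_0) => [[|[]]|[]].
Qed.

Lemma distinct_conjugates_prod M (u : mf_field M) :
  algebraic_integer u -> injective (fun j => mf_emb M j u) ->
  exists2 p : {poly int}, p \is monic &
    map_poly intr p = \prod_j ('X - (mf_emb M j u)%:P).
Proof.
move=> /algebraic_integer_prod_conjugates[p mp pE] uinj; exists p => //.
rewrite pE undup_id; last exact/injectiveP.
by rewrite /codom /image_mem big_map big_enum.
Qed.

Lemma distinct_conjugates_generate M (u : mf_field M) :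
  injective (fun j => mf_emb M j u) -> <<1; u>>%VS = fullv.
Proof.
move=> uinj; have i0 : 'I_n := Ordinal (marked_field_gt0 M).
have mE : n = \dim {: mf_field M} by rewrite mf_degree.
have := congr1 (fun q : {poly R} => size q)
  (minPoly_prod_conjugates i0 u (@mf_emb_inj _ _ M) mE).
rewrite /= size_map_poly size_minPoly size_prod_XsubC undup_id;
  last exact/injectiveP.
rewrite size_codom card_ord => -[degE].
apply/eqP; rewrite eqEdim subvf /= dim_Fadjoin dimv1 muln1 degE.
by rewrite -mE.
Qed.

Lemma eq_emb M (x y : mf_field M) :
  (forall i, mf_emb M i x = mf_emb M i y) -> x = y.
Proof. by move=> /(_ (Ordinal (marked_field_gt0 M))); apply: fmorph_inj. Qed.

Lemma emb_in_alg M i (q : {poly rat}) x :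
  mf_emb M i (map_poly (in_alg (mf_field M)) q).[x] =
  (map_poly ratr q).[mf_emb M i x].
Proof.
rewrite -horner_map; congr (_.[_]); rewrite -map_poly_comp.
by apply: eq_map_poly => a;
  rewrite -[LHS]/((mf_emb M i \o in_alg _) a) fmorph_eq_rat.
Qed.

(** Both [u] and [u'] have the minimal polynomial determined by their common
    conjugates, and [u] generates its field; so [u] can be sent to [u'], and the
    markings are respected because they are on [u]. *)
Lemma conjugates_morphism M M' (u : mf_field M) (u' : mf_field M') :
  injective (fun j => mf_emb M j u) ->
  (forall j, mf_emb M' j u' = mf_emb M j u) ->
  exists phi : {rmorphism mf_field M -> mf_field M'},
    forall j x, mf_emb M' j (phi x) = mf_emb M j x.
Proof.
move=> uinj uu'; have u_gen := distinct_conjugates_generate uinj.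
have [|phi phiu] := @adjoin_rmorphism _ _ (in_alg (mf_field M')) u u' u_gen.
  move=> q /rootP qu; apply/rootP/eq_emb => j.
  by rewrite emb_in_alg uu' -emb_in_alg qu !rmorph0.
exists phi => j x; rewrite -[LHS]/((mf_emb M' j \o phi) x).
apply: (@eq_rmorph_adjoin1 _ _ _ _ u); first by rewrite /= phiu uu'.
by rewrite u_gen memvf.
Qed.

Lemma conjugates_isom M M' (u : mf_field M) (u' : mf_field M') :
  injective (fun j => mf_emb M j u) ->
  (forall j, mf_emb M' j u' = mf_emb M j u) -> mf_isom M M'.
Proof.
move=> uinj uu'; have [phi phiE] := conjugates_morphism uinj uu'.
have [|j|psi psiE] := @conjugates_morphism M' M u' u; last 1 first.
- exists phi => //; exists psi => x; apply: eq_emb => j.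
    by rewrite psiE phiE.
  by rewrite phiE psiE.
- by move=> i j; rewrite !uu'; apply: uinj.
- by rewrite uu'.
Qed.

(** The field is [Q[X] / (p)].  Its embeddings into any extension of [R] are
    given by the image of the class of [X], which must be one of the [x j]; this
    identifies the real embeddings and shows that no embedding into the complex
    numbers is other than real. *)
Lemma marked_field_of_roots (p : {poly int}) (x : 'I_n -> R) :
  injective x -> irreducible_poly (map_poly intr p : {poly rat}) ->
  map_poly intr p = \prod_j ('X - (x j)%:P) ->
  exists M, exists2 z : mf_field M, root (map_poly intr p) z &
    forall j, mf_emb M j z = x j.
Proof.
move=> xinj p_irr pE.
have [L dimL [z]] := irredp_FAdjoin p_irr.
rewrite (map_poly_intr (in_alg L)) => pz0 z_gen.
have size_p : size p = n.+1.
  by rewrite -(size_map_inj_poly (@intr_inj R)) // pE size_prod_XsubC_ord.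
have dvd_p q : root (map_poly (in_alg L) q) z -> map_poly intr p %| q.
  move=> qz0; have [r [mr rE r_dvd]] := minPoly1P z.
  have := r_dvd (map_poly intr p);
    rewrite (map_poly_intr (in_alg L)) => /(_ pz0).
  have sz_r : size r != 1%N.
    by rewrite -(size_map_poly (in_alg L)) -rE size_minPoly.
  by move=> /(p_irr.2 r sz_r)/eqp_dvdl <-; apply: r_dvd.
have px j : root (map_poly intr p) (x j).
  by rewrite pE root_prod_XsubC_ord codom_f.
have ex_emb j : {phi : {rmorphism L -> R} | phi z = x j}.
  apply/cid/(@adjoin_rmorphism _ _ (ratr : rat -> R)) => // q /dvd_p.
  rewrite -(dvdp_map (ratr : {rmorphism rat -> R})) map_poly_intr.
  by move=> /dvdpP[q' ->]; rewrite rootM px orbT.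
pose emb j := sval (ex_emb j).
have embz j : emb j z = x j := svalP (ex_emb j).
have eq_emb (F : fieldType) (sigma tau : {rmorphism L -> F}) :
    sigma z = tau z -> sigma =1 tau.
  by move=> eqz y; apply: (eq_rmorph_adjoin1 eqz); rewrite z_gen memvf.
have root_morph (F : fieldType) (sigma : {rmorphism L -> F}) :
    root (map_poly intr p) (sigma z).
  by rewrite -(map_poly_intr sigma) fmorph_root.
have emb_inj i j : emb i =1 emb j -> i = j.
  by move=> eqij; apply: xinj; rewrite -!embz eqij.
have emb_surj (tau : {rmorphism L -> R}) : exists i, emb i =1 tau.
  have := root_morph _ tau; rewrite pE root_prod_XsubC_ord => /codomP[j tauz].
  by exists j; apply: eq_emb; rewrite embz tauz.
have real_L : totally_real R L.
  move=> tau y.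
  have [j tauz] : exists j, tau z = (x j)%:C%C.
    have := root_morph _ tau.
    rewrite -(map_poly_intr (real_complex R)) pE rmorph_prod /=.
    under eq_bigr => j _ do rewrite map_polyXsubC.
    by rewrite root_prod_XsubC_ord => /codomP[j ->]; exists j.
  have -> : tau y = (real_complex R \o emb j) y.
    by apply: eq_emb; rewrite tauz /= embz.
  by [].
have dim_L : \dim {:L} = n by rewrite dimL size_rat_int_poly size_p.
exists (MarkedField dim_L real_L emb_inj emb_surj).
by exists z.
Qed.

End MarkedFieldTheory.

(** Writing [p = q X + c] with [c = 1] or [c = -1], the inverse of a root [z] is
    [- c q(z)]. *)
Lemma unit_group_root (K : fieldExtType rat) (p : {poly int}) (z : K) :
  p \is monic -> p`_0 * p`_0 = 1 -> root (map_poly intr p) z -> unit_group z.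
Proof.
move=> mp p0 pz0; have z_int : algebraic_integer z by exists p.
split=> //.
have [q [c pE]] : exists q : {poly int}, exists c, p = q * 'X + c%:P.
  elim/poly_ind: (p) => [|r c _]; last by exists r, c.
  by exists 0, 0; rewrite mul0r add0r.
have cE : p`_0 = c by rewrite pE coefD coefMX coefC add0r.
exists (map_poly intr (- (c *: q))).[z].
  apply: integral_horner => //; apply/integral_poly => i.
  by rewrite coef_map; apply: integral_id.
have := rootP pz0.
rewrite pE rmorphD rmorphM /= map_polyX map_polyC !hornerE /=.
move=> /eqP; rewrite addr_eq0 => /eqP qzE.
rewrite rmorphN /= map_polyZ /= !hornerE mulrN mulrCA [z * _]mulrC qzE.
by rewrite mulrN opprK -intrM -cE p0.
Qed.

(** * Polynomials with prescribed elementary symmetric functions *)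
(** When [m 0 = 1], this is the monic polynomial whose roots have the [m k] as
    elementary symmetric functions. *)
Definition alt_poly (A : nzRingType) n (m : nat -> A) : {poly A} :=
  \sum_(k < n.+1) ((-1) ^+ k * m k) *: 'X^(n - k).

Lemma coef_alt_poly (A : nzRingType) n (m : nat -> A) k : (k <= n)%N ->
  (alt_poly n m)`_(n - k) = (-1) ^+ k * m k.
Proof.
move=> kn; rewrite coef_sum (bigD1 (inord k)) //= inordK // coefZ coefXn eqxx
  mulr1.
rewrite big1 ?addr0 // => j jk; rewrite coefZ coefXn; case: eqP;
  last by rewrite mulr0.
move=> jkE; case/eqP: jk; apply/val_inj; rewrite /= inordK //.
by have := ltn_ord j; lia.
Qed.

Lemma size_alt_poly_le (A : nzRingType) n (m : nat -> A) :
  (size (alt_poly n m) <= n.+1)%N.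
Proof.
apply: (leq_trans (size_sum _ _ _)); apply/bigmax_leqP => k _.
by apply: (leq_trans (size_scale_leq _ _)); rewrite size_polyXn ltnS leq_subr.
Qed.

Lemma alt_poly_monic (A : nzRingType) n (m : nat -> A) : m 0%N = 1 ->
  alt_poly n m \is monic /\ size (alt_poly n m) = n.+1.
Proof.
move=> m0; have cn : (alt_poly n m)`_n = 1.
  by have := coef_alt_poly m (leq0n n); rewrite subn0 expr0 mul1r m0.
have sz : size (alt_poly n m) = n.+1.
  apply/eqP; rewrite eqn_leq size_alt_poly_le ltnNge /=; apply/negP => le_n.
  by move: cn; rewrite nth_default // => /eqP; rewrite eq_sym oner_eq0.
by split=> //; rewrite monicE lead_coefE sz cn.
Qed.

Lemma map_alt_poly (A B : nzRingType) (f : {rmorphism A -> B}) n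
    (m : nat -> A) :
  map_poly f (alt_poly n m) = alt_poly n (f \o m).
Proof.
rewrite rmorph_sum; apply: eq_bigr => k _.
by rewrite /= map_polyZ map_polyXn rmorphM rmorphXn rmorphN1.
Qed.

Lemma horner_alt_poly (A : comNzRingType) n (m : nat -> A) y :
  (alt_poly n m).[y] = \sum_(k < n.+1) (-1) ^+ k * (m k * y ^+ (n - k)).
Proof.
rewrite horner_sum; apply: eq_bigr => k _.
by rewrite hornerZ hornerXn mulrA.
Qed.

Lemma irreducible_poly_shift (F : fieldType) (p : {poly F}) c :
  irreducible_poly (p \Po ('X + c%:P)) -> irreducible_poly p.
Proof.
have sz2 (a : F) : size ('X + a%:P) = 2%N by rewrite size_XaddC.
have sz2' : size ('X - c%:P) = 2%N by rewrite size_XsubC.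
case; rewrite size_comp_poly2 // => p_gt1 p_irr; split=> // d d1 dp.
have /andP[_ qd] : d \Po ('X + c%:P) %= p \Po ('X + c%:P).
  by apply: p_irr; rewrite ?size_comp_poly2 // dvdp_comp_poly.
rewrite /eqp dp /= -(comp_polyXaddC_K d c) -(comp_polyXaddC_K p c).
exact: dvdp_comp_poly.
Qed.

(** The substitution of [X + 1] for [X] gives [X^n + 2 h(X + 1)], whose constant
    coefficient [2 h(1)] is even but not divisible by 4. *)
Lemma irreducible_shifted_eisenstein n (h : {poly int}) :
  (0 < n)%N -> (size h <= n)%N -> ~~ (2 %| h.[1])%Z ->
  irreducible_poly (map_poly intr (('X - 1) ^+ n + 2 *: h) : {poly rat}).
Proof.
move=> n_gt0 sz_h h1_odd; apply: (@irreducible_poly_shift _ _ 1).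
pose g := h \Po ('X + 1%:P).
have sz_g : (size g <= n)%N by rewrite size_comp_poly2 // size_XaddC.
have -> : map_poly intr (('X - 1) ^+ n + 2 *: h) \Po ('X + 1%:P) =
    map_poly intr ('X^n + 2 *: g) :> {poly rat}.
  rewrite [RHS](_ : _ =
      map_poly intr ((('X - 1) ^+ n + 2 *: h) \Po ('X + 1%:P))).
    by rewrite map_comp_poly [in RHS](rmorphD _ 'X) /= map_polyX map_polyC.
  congr map_poly; rewrite comp_polyD comp_polyZ rmorphXn /= comp_polyB.
  by rewrite comp_polyX comp_polyC addrK.
have gn : g`_n = 0 by rewrite nth_default.
have cn : ('X^n + 2 *: g)`_n = 1.
  by rewrite coefD coefXn eqxx coefZ gn mulr0 addr0.
have sz : size ('X^n + 2 *: g) = n.+1.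
  rewrite size_polyDl size_polyXn // ltnS.
  exact: leq_trans (size_scale_leq _ _) sz_g.
apply/irreducible_rat_int; apply: (@eisenstein_crit 2) => //.
- by rewrite sz eqSS -lt0n.
- by rewrite lead_coefE sz /= cn.
- rewrite coefD coefXn eq_sym eqn0Ngt n_gt0 /= add0r coefZ.
  rewrite -horner_coef0 horner_comp !hornerE.
  by rewrite -[Posz (2%N ^+ 2)]/(2 * 2 : int) dvdz_mul2l.
- move=> i; rewrite sz /= => i_n.
  by rewrite coefD coefXn (ltn_eqF i_n) add0r coefZ dvdz_mulr.
Qed.

(** The binomial coefficients are the [m k] of [(X - 1)^n]. *)
Lemma alt_poly_irreducible n (h : nat -> int) :
  (0 < n)%N -> h 0%N = 0 -> ~~ (2 %| \sum_(k < n.+1) (-1) ^+ k * h k)%Z ->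
  irreducible_poly
    (map_poly intr (alt_poly n (fun k => 'C(n, k)%:Z + 2 * h k)) : {poly rat}).
Proof.
move=> n_gt0 h0 h_odd.
have -> : alt_poly n (fun k => 'C(n, k)%:Z + 2 * h k) =
    ('X - 1) ^+ n + 2 *: alt_poly n h.
  rewrite exprBn scaler_sumr -big_split; apply: eq_bigr => k _ /=.
  rewrite expr1n mulr1 mulrDr scalerDl; congr (_ + _).
    rewrite -scaler_nat -mul_polyC -mul_polyC rmorphM rmorphXn rmorphN1 /=.
    rewrite mulrA [X in _ = X * _]mulrC natz; congr (_ * _ * _).
  by rewrite scalerA mulrCA.
apply: irreducible_shifted_eisenstein => //.
  have := size_alt_poly_le n h; rewrite leq_eqVlt => /orP[/eqP sz|//].
  have := coef_alt_poly h (leq0n n); rewrite subn0 h0 mulr0 => cn.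
  have : lead_coef (alt_poly n h) == 0 by rewrite lead_coefE sz /= cn.
  by rewrite lead_coef_eq0 -size_poly_eq0 sz.
rewrite horner_alt_poly.
by under eq_bigr => k _ do rewrite expr1n mulr1.
Qed.

Section Domination.
Variable R : realType.
Implicit Types (T L : nat -> R).

Lemma alt_sum_sign n (T : nat -> R) d : (d <= n)%N ->
  (forall j, (j <= n)%N -> 0 <= T j) ->
  \sum_(j < n.+1 | j != d :> nat) T j < T d ->
  0 < (-1) ^+ d * \sum_(j < n.+1) (-1) ^+ j * T j.
Proof.
move=> dn T0 Td; rewrite (bigD1 (inord d)) //= inordK // mulrDr mulrA -expr2.
rewrite sqrr_sign mul1r mulr_sumr -(opprK (\sum_(i < _ | _) _)) subr_gt0.
apply: le_lt_trans Td; apply: le_trans (ler_norm _) _; rewrite normrN.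
apply: le_trans (ler_norm_sum _ _ _) _.
rewrite [leLHS](eq_bigl (fun j : 'I_n.+1 => j != d :> nat)); last first.
  by move=> j; rewrite -val_eqE /= inordK.
apply: ler_sum => j _; rewrite !normrM !normr_sign !mul1r ger0_norm //.
by apply: T0; rewrite -ltnS.
Qed.

(** Here [L j] is the approximate logarithm of the term [T j], [d] is the
    dominating term and [o] the only one that is comparable to it: [T o] is
    smaller than [T d] by a factor [expR (- eta)], the [n - 1] other terms by a
    factor [expR (- M)] which will be tiny. *)
Lemma alt_sum_dominated n (T L : nat -> R) d o r eta M : (d <= n)%N ->
  (forall j, (j <= n)%N -> expR (L j) <= T j <= r * expR (L j)) ->
  L o <= L d - eta ->
  (forall j, (j <= n)%N -> j != d -> j != o -> L j <= L d - M) ->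
  0 <= r -> r * (expR (- eta) + n%:R * expR (- M)) < 1 ->
  0 < (-1) ^+ d * \sum_(j < n.+1) (-1) ^+ j * T j.
Proof.
move=> dn TL Lo Lj r0 small; apply: alt_sum_sign => // [j jn|].
  by have /andP[/(le_trans (expR_ge0 _))] := TL j jn.
have /andP[/(lt_le_trans _)-> //] := TL d dn.
pose b (j : 'I_n.+1) : R := if j == o :> nat then expR (- eta) else expR (- M).
apply: (@le_lt_trans _ _
  (\sum_(j < n.+1 | j != d :> nat) r * expR (L d) * b j)).
  apply: ler_sum => j jd; have /andP[_ /le_trans->//] := TL j (ltn_ord j).
  rewrite -mulrA ler_wpM2l // /b; case: eqP => [->|/eqP jo].
    by rewrite -expRD ler_expR.
  by rewrite -expRD ler_expR Lj // -ltnS.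
rewrite -mulr_sumr mulrAC gtr_pMl ?expR_gt0 //; apply: le_lt_trans small.
rewrite ler_wpM2l //.
rewrite (bigID (fun j : 'I_n.+1 => j == o :> nat)) /=; apply: lerD.
  (* For [o > n] no term has index [o]. *)
  case: (leqP o n) => on; last first.
    rewrite big_pred0 ?expR_ge0 // => j; apply/negbTE; rewrite negb_and.
    by rewrite orbC neq_ltn (leq_trans (ltn_ord j)).
  apply: (@le_trans _ _ (\sum_(j < n.+1 | j == inord o) expR (- eta))).
    rewrite big_mkcond [leRHS]big_mkcond; apply: ler_sum => j _.
    rewrite /b -(inj_eq val_inj) /= inordK //.
    by case: (j == o :> nat); rewrite ?andbF ?andbT //; case: ifP;
      rewrite ?expR_ge0.
  by rewrite big_pred1_eq.
apply: (@le_trans _ _ (\sum_(j < n.+1 | j != inord d) expR (- M))).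
  rewrite big_mkcond [leRHS]big_mkcond; apply: ler_sum => j _.
  rewrite /b -(inj_eq val_inj) /= inordK //.
  by case: (j == o :> nat); case: (j == d :> nat); rewrite //= expR_ge0.
by rewrite sumr_const cardC1 card_ord /= mulr_natl.
Qed.

End Domination.

Section RootLocation.
Variables (R : realType) (n : nat) (v : nat -> R) (g : R).
Hypothesis g_ge0 : 0 <= g.
Hypothesis v_gap : forall i j, (i < j < n)%N -> v j <= v i - g.

Definition partial_sum k : R := \sum_(i < k) v i.
Local Notation s := partial_sum.

Lemma partial_sumS k : s k.+1 = s k + v k.
Proof. exact: big_ord_recr. Qed.

(** As [v] decreases, [j |-> s j - j * v k] is concave, and its maximum is taken
    exactly at [k] and [k + 1]. Applied to the logarithms of the monomials, this
    tells which ones dominate near the [k]-th root. *)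
Lemma partial_sum_gap k j : (k < n)%N -> (j <= n)%N -> j != k -> j != k.+1 ->
  s j <= s k + (j%:R - k%:R) * v k - g.
Proof.
move=> kn jn jk jk1; have [lt_jk|le_kj] := ltnP j k.
  have up i : (j.+1 + i <= k)%N -> s j + i.+1%:R * v k + g <= s (j.+1 + i)%N.
    elim: i => [_|i IH]; rewrite ?addn0 ?addnS.
      by have := @v_gap j k; rewrite lt_jk kn partial_sumS => /(_ isT); lra.
    move=> le_k; rewrite partial_sumS mulrSr; have := IH (ltnW le_k).
    by have := @v_gap (j.+1 + i) k; rewrite le_k kn => /(_ isT); move: g_ge0;
      lra.
  have := up (k - j.+1)%N;
    rewrite subnKC // subnSK // natrB ?(ltnW lt_jk) // leqnn => /(_ isT).
  lra.
have lt_kj : (k.+2 <= j)%N.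
  by rewrite ltn_neqAle eq_sym jk1 ltn_neqAle eq_sym jk.
have down i : (k.+2 + i <= n)%N -> s (k.+2 + i)%N <= s k + i.+2%:R * v k - g.
  elim: i => [|i IH]; rewrite ?addn0 ?addnS => le_n.
    by have := @v_gap k k.+1; rewrite leqnn le_n !partial_sumS => /(_ isT); lra.
  rewrite partial_sumS mulrSr; have := IH (ltnW le_n).
  have /v_gap : (k < k.+2 + i < n)%N by rewrite le_n andbT; lia.
  by move: g_ge0; lra.
have jkE : (j - k.+2).+2 = (j - k)%N by lia.
have le_kj' : (k <= j)%N by lia.
have := down (j - k.+2)%N; rewrite subnKC // jkE natrB // => /(_ jn).
by lra.
Qed.

Section AltPolyRoots.
Variables (t eta delta : R) (m : nat -> R).
Hypotheses (t_ge0 : 0 <= t) (eta_gt0 : 0 < eta) (delta_ge0 : 0 <= delta).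
Hypothesis eta_small : 2 * eta < t * g.
Hypothesis dominated :
  (1 + delta) * (expR (- eta) + n%:R * expR (- (t * g - n%:R * eta))) < 1.
Hypothesis m0 : m 0%N = 1.
Hypothesis m_bounds : forall k, (k <= n)%N ->
  expR (t * s k) <= m k <= (1 + delta) * expR (t * s k).

Let P := alt_poly n m.

(** At [expR (t * v k + h)] the monomials of index [k] and [k + 1] exceed all
    the others by [partial_sum_gap]; the sign of [h] decides which one of them
    is the larger, here called [d]. *)
Let alt_poly_sign k h d o : (k < n)%N -> `|h| <= eta ->
  (d == k) || (d == k.+1) -> (o == k) || (o == k.+1) -> d != o ->
  t * (s o - o%:R * v k) + (n%:R - o%:R) * h <=
  t * (s d - d%:R * v k) + (n%:R - d%:R) * h - eta ->
  0 < (-1) ^+ d * P.[expR (t * v k + h)].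
Proof.
move=> kn h_eta dk ok neq_do Lo; rewrite horner_alt_poly.
(* The logarithm of the [j]-th monomial, up to the factor [1 + delta]. *)
pose L j := t * s j + (n%:R - j%:R) * (t * v k + h).
have dn : (d <= n)%N by case/orP: dk => /eqP-> //; apply: ltnW.
pose T j := m j * expR (t * v k + h) ^+ (n - j).
pose M := t * g - n%:R * eta.
apply: (@alt_sum_dominated R n T L d o (1 + delta) eta M) => //.
- move=> j jn; rewrite /T -expRM_natl natrB // /L expRD mulrA.
  by rewrite !ler_pM2r ?expR_gt0 ?m_bounds.
- by move: Lo; rewrite /L; lra.
- move=> j jn jd jo.
  have jk : j != k by move: dk ok jd jo neq_do; clear; lia.
  have jk1 : j != k.+1 by move: dk ok jd jo neq_do; clear; lia.
  have sd : s d - d%:R * v k = s k - k%:R * v k.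
    by case/orP: dk => /eqP-> //; rewrite partial_sumS mulrSr; ring.
  have := ler_wpM2l t_ge0 (partial_sum_gap kn jn jk jk1).
  have djh : (d%:R - j%:R) * h <= n%:R * eta.
    apply: le_trans (ler_norm _) _; rewrite normrM ler_pM //.
    have := ler0n R d; have := ler0n R j.
    have : (d%:R : R) <= n%:R by rewrite ler_nat.
    have : (j%:R : R) <= n%:R by rewrite ler_nat.
    by move=> *; rewrite ler_norml; apply/andP; split; lra.
  have : t * (s d - d%:R * v k) = t * (s k - k%:R * v k) by rewrite sd.
  by move: djh; rewrite /L /M; lra.
- by rewrite addr_ge0.
Qed.

Let root_between k : (k < n)%N ->
  exists2 x, expR (t * v k - eta) <= x <= expR (t * v k + eta) & root P x.
Proof.
move=> kn; have eta_ge0 := ltW eta_gt0.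
have Pr : 0 < (-1) ^+ k * P.[expR (t * v k + eta)].
  apply: (@alt_poly_sign k eta k k.+1); rewrite ?eqxx ?orbT ?ger0_norm //.
    by rewrite neq_ltn ltnSn.
  by rewrite partial_sumS mulrSr; lra.
have Pl : 0 < (-1) ^+ k.+1 * P.[expR (t * v k - eta)].
  apply: (@alt_poly_sign k (- eta) k.+1 k);
    rewrite ?eqxx ?orbT ?normrN ?ger0_norm //.
    by rewrite neq_ltn ltnSn orbT.
  by rewrite partial_sumS mulrSr; lra.
have [||x xI] := @poly_ivt R ((-1) ^+ k *: P)
  (expR (t * v k - eta)) (expR (t * v k + eta)).
- by rewrite ler_expR; lra.
- by rewrite !hornerZ (ltW Pr) andbT -oppr_ge0 -mulNr -mulN1r -exprS ltW.
by rewrite rootZ ?signr_eq0 // => Px; exists x.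
Qed.

Lemma alt_poly_roots : exists x : 'I_n -> R,
  [/\ injective x, P = \prod_j ('X - (x j)%:P) &
      forall j : 'I_n, expR (t * v j - eta) <= x j <= expR (t * v j + eta)].
Proof.
have ex_root (j : 'I_n) :
    {x | expR (t * v j - eta) <= x <= expR (t * v j + eta) /\ root P x}.
  by apply: cid; have [x] := root_between (ltn_ord j); exists x.
pose x j := sval (ex_root j).
have xP (j : 'I_n) :
    expR (t * v j - eta) <= x j <= expR (t * v j + eta) /\ root P (x j).
  exact: (svalP (ex_root j)).
have x_lt (i j : 'I_n) : (i < j)%N -> x j < x i.
  move=> ij; have [/andP[le_xi _] _] := xP i; have [/andP[_ le_xj] _] := xP j.
  apply: (le_lt_trans le_xj); apply: lt_le_trans le_xi; rewrite ltr_expR.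
  have := @v_gap i j; rewrite ij ltn_ord => /(_ isT) vij.
  by have := ler_wpM2l t_ge0 vij; move: eta_small; lra.
have xinj : injective x by exact: decreasing_injective.
have [P_monic sz_P] := alt_poly_monic n m0.
exists x; split=> // [|j]; last by have [] := xP j.
have rs_P : all (root P) (codom x).
  by apply/allP => y /codomP[j ->]; have [] := xP j.
rewrite -/P in P_monic sz_P.
have sz_rs : size P = (size (codom x)).+1 by rewrite sz_P size_codom card_ord.
have uniq_rs : uniq_roots (codom x) by rewrite uniq_rootsE; apply/injectiveP.
rewrite [LHS](all_roots_prod_XsubC sz_rs rs_P uniq_rs) (monicP P_monic) scale1r.
by rewrite /codom /image_mem big_map big_enum.
Qed.

End AltPolyRoots.

End RootLocation.

(** * Norms on row vectors *)
Section NormEquivalence.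
Variables (R : realType) (n : nat) (nrm : 'rV[R]_n -> R).
Hypothesis nrmP : is_norm nrm.

Lemma nrm0 : nrm 0 = 0.
Proof. by have := is_normZ nrmP 0 0; rewrite scale0r normr0 mul0r. Qed.

Lemma nrmN x : nrm (- x) = nrm x.
Proof. by rewrite -scaleN1r (is_normZ nrmP) normrN1 mul1r. Qed.

Lemma nrm_sum (J : Type) (r : seq J) (F : J -> 'rV[R]_n) :
  nrm (\sum_(i <- r) F i) <= \sum_(i <- r) nrm (F i).
Proof.
apply: (big_ind2 (fun x y => nrm x <= y)) => // [|x1 y1 x2 y2 le1 le2].
  by rewrite nrm0.
exact: le_trans (is_normD nrmP _ _) (lerD le1 le2).
Qed.

Lemma nrm_le_coord : exists2 C, 0 < C &
  forall (x : 'rV[R]_n) a, 0 <= a -> (forall j, `|x ord0 j| <= a) ->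
    nrm x <= C * a.
Proof.
exists (\sum_j nrm (delta_mx ord0 j) + 1) => [|x a a_ge0 xa].
  by rewrite ltr_wpDl // sumr_ge0 // => j _; apply: (is_norm_ge0 nrmP).
rewrite mulrDl mul1r ler_wpDr // mulr_suml {1}[x]row_sum_delta.
apply: le_trans (nrm_sum _ _) _; apply: ler_sum => j _.
by rewrite (is_normZ nrmP) mulrC ler_wpM2l // (is_norm_ge0 nrmP).
Qed.

Lemma nrm_lip x y : `|nrm x - nrm y| <= nrm (x - y).
Proof.
have le_sub a b : nrm a - nrm b <= nrm (a - b).
  by rewrite lerBlDr -{1}[a](subrK b) (is_normD nrmP).
by rewrite ler_norml le_sub andbT lerNl opprB -[leRHS]nrmN opprB le_sub.
Qed.

Lemma coord_le_mx_norm (x : 'rV[R]_n) j : `|x ord0 j| <= `|x|.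
Proof.
by rewrite [leRHS]/Num.norm /= mx_normrE; apply/bigmax_geP; right => /=;
  exists (ord0, j).
Qed.

Lemma nrm_continuous : continuous nrm.
Proof.
have [C C_gt0 nrm_le] := nrm_le_coord.
move=> x; apply/(@cvgrPdist_lt _ _ _ _ (nbhs_filter x)) => e e_gt0; near=> y.
apply: (le_lt_trans (nrm_lip _ _)).
apply: (@le_lt_trans _ _ (C * `|x - y|)).
  by apply: nrm_le => // j; exact: coord_le_mx_norm.
rewrite mulrC -ltr_pdivlMr //; near: y.
by apply: cvgr_dist_lt; rewrite ?divr_gt0.
Unshelve. all: by end_near. Qed.

(** A norm is continuous, so it has a positive minimum on the unit sphere of the
    supremum norm, which is compact. *)
Lemma coord_le_nrm : exists2 C, 0 < C &
  forall (x : 'rV[R]_n) j, `|x ord0 j| <= C * nrm x.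
Proof.
pose S := [set x : 'rV[R]_n | `|x| = 1].
have cpt_S : compact S.
  apply: bounded_closed_compact.
    by exists 1; split=> // a a1 x /= ->; apply: ltW.
  apply: (@preimage_closed _ _ (fun x : 'rV[R]_n => `|x|) [set 1]) => [x _|].
    exact: norm_continuous.
  exact: closed_eq.
(* The sphere is empty when [n = 0]. *)
have [S0|/set0P S0] := eqVneq S set0.
  exists 1 => // x j; suff -> : x = 0 by rewrite mxE normr0 nrm0 mulr0.
  apply/eqP/negP => /negP x0.
  have : S (`|x|^-1 *: x).
    by rewrite /S /= normrZ normfV normr_id mulVf // normr_eq0.
  by rewrite S0.
have [|c /set_mem cS c_min] := compact_EVT_min S0 cpt_S (f := nrm).
  by apply: continuous_subspaceT; exact: nrm_continuous.
have c_gt0 : 0 < nrm c.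
  rewrite lt_neqAle (is_norm_ge0 nrmP) andbT eq_sym;
    apply/eqP => /(is_norm_eq0 nrmP) c0.
  by move: cS; rewrite /S /= c0 normr0 => /eqP; rewrite eq_sym oner_eq0.
exists (nrm c)^-1; rewrite ?invr_gt0 // => x j.
apply: (le_trans (coord_le_mx_norm x j)).
have [->|x0] := eqVneq x 0; first by rewrite normr0 nrm0 mulr0.
have xS : S (`|x|^-1 *: x).
  by rewrite /S /= normrZ normfV normr_id mulVf // normr_eq0.
have := c_min _ (mem_set xS); rewrite (is_normZ nrmP) normfV normr_id.
by rewrite ler_pdivlMl ?normr_gt0 // ler_pdivlMl // mulrC.
Qed.

End NormEquivalence.

(** * Units with small logarithms *)
Section SmallUnits.
Variables (R : realType) (n : nat) (M : marked_field R n).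

(** The conjugates of [u ^+ 2 - 1] are of the form [y - 1] with
    [1 / 2 < y < 2], so all of them have absolute value less than 1. *)
Lemma small_log_torsion (u : mf_field M) : algebraic_integer u -> u != 0 ->
  (forall j, `|ln `|mf_emb M j u| | < ln 2 / 2) -> u = 1 \/ u = -1.
Proof.
move=> u_int u0 small.
suff /eqP : u ^+ 2 - 1 = 0.
  by rewrite subr_eq0 sqrf_eq1 => /orP[]/eqP; [left|right].
apply: contrapT => /eqP w0.
have w_int : algebraic_integer (u ^+ 2 - 1).
  by apply: integral_sub; [rewrite expr2; apply: integral_mul|apply: integral1].
have [j] := algebraic_integer_conjugate_ge1 w_int w0; apply/negP;
  rewrite -ltNge.
have x_gt0 : 0 < `|mf_emb M j u| by rewrite normr_gt0 fmorph_eq0.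
rewrite rmorphB rmorphXn rmorph1 -real_normK ?num_real //.
set x := `|_| in x_gt0 *.
have ln2_gt0 : 0 < ln 2 :> R by rewrite ln_gt0 // ltr1n.
have xE : x ^+ 2 = expR (2%:R * ln x) by rewrite expRM_natl lnK.
have := small j; rewrite -/x ltr_norml => /andP[lo hi].
have x2_lt : x ^+ 2 < 2.
  by rewrite xE -[ltRHS](@lnK R) ?posrE // ltr_expR; move: hi; lra.
have x2_gt : 0 < x ^+ 2 by rewrite exprn_gt0.
by rewrite ltr_norml; apply/andP; split; lra.
Qed.

End SmallUnits.

(** * Counting by finite types *)
Section Counting.
Variables (R : realType) (T : choiceType) (FT : finType) (A : set T).

Lemma counting_le_card (code : T -> FT -> Prop) :
  (forall u, A u -> exists f, code u f) ->
  (forall u u' f, A u -> A u' -> code u f -> code u' f -> u = u') ->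
  (counting A <= #|FT|%:R%:E :> \bar R)%E.
Proof.
move=> ex_code code_inj; have [->|/set0P[u0 Au0]] := eqVneq A set0.
  by rewrite /counting asboolT // fset_set0 lee_fin.
have [f0 _] := ex_code _ Au0.
have ex_f u : {f : FT | A u -> code u f}.
  apply: cid; have [/ex_code[f fP]|nAu] := pselect (A u); first by exists f.
  by exists f0.
pose f u := sval (ex_f u).
have codeP u : A u -> code u (f u) := svalP (ex_f u).
have A_le : (A #<= `I_#|FT|)%card.
  apply/pcard_leP/injfunPex; exists (fun u => nat_of_ord (enum_rank (f u))).
    by move=> u _ /=; exact: ltn_ord.
  move=> u u' /set_mem Au /set_mem Au' /ord_inj/enum_rank_inj fuu'.
  by apply: (code_inj _ _ (f u)) => //;
    [exact: codeP | rewrite fuu'; exact: codeP].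
rewrite /counting asboolT; last by apply/finite_set_leP; exists #|FT|.
by rewrite lee_fin ler_nat geq_card_fset_set.
Qed.

Lemma card_le_counting (g : FT -> T) :
  injective g -> (forall f, A (g f)) -> (#|FT|%:R%:E <= counting A :> \bar R)%E.
Proof.
move=> g_inj gA; rewrite /counting; case: asboolP => [finA|_]; last exact: leey.
rewrite lee_fin ler_nat; apply: leq_card_fset_set => //.
pose h (i : 'I_#|FT|) := g (enum_val i).
have h_inj : {in [set: 'I_#|FT|] &, injective h}.
  by move=> i j _ _ /g_inj/enum_val_inj.
rewrite (card_le_eql card_II) -(card_le_eql (inj_card_eq h_inj)).
by apply: subset_card_le => _ [i _ <-]; exact: gA.
Qed.

End Counting.

(** * Polynomials with ordered roots *)
Section DecreasingRoots.
Variables (R : realDomainType) (n : nat).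

Lemma eq_decreasing_roots (x y : 'I_n -> R) :
  (forall i j : 'I_n, (i < j)%N -> `|x j| < `|x i|) ->
  (forall i j : 'I_n, (i < j)%N -> `|y j| < `|y i|) ->
  \prod_j ('X - (x j)%:P) = \prod_j ('X - (y j)%:P) -> x =1 y.
Proof.
move=> x_dec y_dec xy; pose gtn_norm (a b : R) := `|b| < `|a|.
have codom_sorted (z : 'I_n -> R) :
    (forall i j : 'I_n, (i < j)%N -> `|z j| < `|z i|) ->
      sorted gtn_norm (codom z).
  move=> z_dec; rewrite /codom /image_mem sorted_map.
  apply: (@sub_sorted _ (relpre val ltn)); first by move=> i j /=; apply: z_dec.
  by rewrite -sorted_map val_enum_ord iota_ltn_sorted.
have eq_codom : codom x = codom y.
  apply: (@irr_sorted_eq _ gtn_norm) => [a b c|a|||a];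
    rewrite /gtn_norm ?ltxx //.
  - by move=> ba ac; apply: lt_trans ac ba.
  - exact: codom_sorted.
  - exact: codom_sorted.
  - by rewrite -!root_prod_XsubC_ord xy.
move=> j; have nth_codom z : nth 0 (codom z) j = z j.
  by rewrite /codom /image_mem (nth_map j) ?size_enum_ord // nth_ord_enum.
by rewrite -nth_codom eq_codom nth_codom.
Qed.

End DecreasingRoots.

Section CoefficientBound.
Variables (R : realDomainType) (x y : nat -> R).
Hypothesis y_ge0 : forall j, 0 <= y j.

(** The coefficient is a sum of at most [2 ^+ n] products of [k] of the roots,
    and the product of the [k] largest bounds is the largest of all. *)
Lemma coef_prod_XsubC_le n :
  (forall j, (j < n)%N -> `|x j| <= y j) ->
  (forall i j, (i <= j < n)%N -> y j <= y i) ->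
  forall k, (k <= n)%N ->
  `|(\prod_(j < n) ('X - (x j)%:P))`_(n - k)| <= 2 ^+ n * \prod_(j < k) y j.
Proof.
elim: n => [|n IH] xy y_mono k.
  by rewrite leqn0 => /eqP->; rewrite !big_ord0 coef1 normr1 expr0 mul1r.
have {}IH := IH (fun j jn => xy j (ltnW jn)) _.
have {}IH : forall k, (k <= n)%N ->
    `|(\prod_(j < n) ('X - (x j)%:P))`_(n - k)| <= 2 ^+ n * \prod_(j < k) y j.
  by apply: IH => i j /andP[ij jn]; rewrite y_mono // ij ltnW.
set P := \prod_(j < n) _ in IH *.
have prod_ge0 m : 0 <= \prod_(j < m) y j by apply: prodr_ge0.
rewrite big_ord_recr /= -/P => kn.
have szP : size P = n.+1 by exact: size_prod_XsubC_ord.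
have -> : (P * ('X - (x n)%:P))`_(n.+1 - k) =
    (if (k <= n)%N then P`_(n - k) else 0)
    - x n * (if k is k'.+1 then P`_(n - k') else 0).
  rewrite mulrBr coefB coefMX coefMC mulrC; congr (_ - _ * _).
    case: leqP => [le_kn|lt_nk]; first by rewrite subSn.
    by have -> : (n.+1 - k = 0)%N by lia.
  by case: k {kn} => [|k]; rewrite ?subSS // subn0 nth_default // szP.
apply: (le_trans (ler_normB _ _)).
have pow_ge0 : 0 <= 2 ^+ n :> R by rewrite exprn_ge0.
rewrite exprS mulrDl mul1r mulrDl; apply: lerD.
  by case: leqP => [/IH//|_]; rewrite normr0 mulr_ge0 ?prod_ge0.
rewrite normrM; case: k kn => [|k] kn;
  first by rewrite normr0 mulr0 mulr_ge0 ?prod_ge0.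
rewrite big_ord_recr /= mulrA [leRHS]mulrC; apply: ler_pM => //; last exact: IH.
by apply: le_trans (xy n _) (y_mono k n _) => //; rewrite -ltnS kn ltnSn.
Qed.

End CoefficientBound.

(** * Points of the Weyl chamber *)
Section Chamber.
Variables (R : realType) (n : nat) (v : 'rV[R]_n).
Hypothesis vP : weyl_chamber v.

(** Coordinates are indexed by natural numbers so that partial sums can be split
    off by recursion; the value 0 outside of the range is arbitrary. *)
Definition nat_coord (i : nat) : R := oapp (v ord0) 0 (insub i).

Lemma nat_coordE (j : 'I_n) : nat_coord j = v ord0 j.
Proof. by rewrite /nat_coord valK. Qed.

Local Notation s := (partial_sum nat_coord).

Lemma partial_sum_full : s n = 0.
Proof.
by rewrite -[RHS]vP.1; apply: eq_bigr => j _; rewrite nat_coordE.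
Qed.

Lemma chamber_gap : exists2 g, 0 < g &
  forall i j, (i < j < n)%N -> nat_coord j <= nat_coord i - g.
Proof.
exists (\big[Num.min/1]_(p : 'I_n * 'I_n | (p.1 < p.2)%N)
          (v ord0 p.1 - v ord0 p.2)).
  by apply: lt_bigmin => // -[i j] /= ij; rewrite subr_gt0 vP.2.
move=> i j /andP[ij jn]; pose i' := Ordinal (ltn_trans ij jn);
  pose j' := Ordinal jn.
rewrite (nat_coordE i') (nat_coordE j') lerBrDr -lerBrDl.
have := @bigmin_le_cond _ R _ 1 (i', j') (fun p : 'I_n * 'I_n => p.1 < p.2)%N
  (fun p => v ord0 p.1 - v ord0 p.2) ij.
by [].
Qed.

(** Comparing [s k] with [s 0 = 0] and with [s n = 0] by [partial_sum_gap] and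
    eliminating [v k] leaves a positive lower bound.  When [n = k + 1], the
    second comparison is the equality [s k = - v k]. *)
Lemma partial_sum_ge g : 0 < g ->
  (forall i j, (i < j < n)%N -> nat_coord j <= nat_coord i - g) ->
  forall k, (0 < k < n)%N -> g / n%:R <= s k.
Proof.
move=> g_gt0 gap k /andP[k_gt0 kn].
have n_gt0 : 0 < n%:R :> R by rewrite ltr0n (leq_trans _ kn).
rewrite ler_pdivrMr //.
have s0 : s 0 = 0 by rewrite /partial_sum big_ord0.
have k0 := partial_sum_gap (ltW g_gt0) gap kn (leq0n n) _ _.
have {}k0 : s 0 <= s k + (0%:R - k%:R) * nat_coord k - g.
  by apply: k0; rewrite // neq_ltn ?k_gt0.
have k_ge1 : 1 <= k%:R :> R by rewrite ler1n.
have kn1 : k.+1%:R <= n%:R :> R by rewrite ler_nat.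
rewrite mulrSr in kn1.
have [nk|nk] := eqVneq n k.+1.
  have := partial_sum_full; rewrite {1}nk partial_sumS => sk.
  have nkE : n%:R = k%:R + 1 :> R by rewrite nk mulrSr.
  have vk : nat_coord k = - s k by lra.
  by move: k0; rewrite s0 vk nkE; lra.
have := partial_sum_gap (ltW g_gt0) gap kn (leqnn n) _ nk.
rewrite partial_sum_full => /(_ _) kn'.
have {}kn' : 0 <= s k + (n%:R - k%:R) * nat_coord k - g.
  by apply: kn'; rewrite neq_ltn kn orbT.
by rewrite s0 in k0; nra.
Qed.

Lemma partial_sum_ge0 k : (k <= n)%N -> 0 <= s k.
Proof.
rewrite leq_eqVlt => /orP[/eqP->|kn]; first by rewrite partial_sum_full.
case: (posnP k) => [->|k_gt0]; first by rewrite /partial_sum big_ord0.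
have [g g_gt0 gap] := chamber_gap.
have k_in : (0 < k < n)%N by rewrite k_gt0.
by apply: le_trans (partial_sum_ge g_gt0 gap k_in); rewrite divr_ge0 // ltW.
Qed.

Definition chamber_entropy : R :=
  \sum_(j < n | (j.+1 <= n.-1)%N) (n - j.+1)%:R * v ord0 j.

(** Each [v j] occurs in [n - j] of the partial sums; one occurrence of every
    [v j] can be dropped because their sum is 0. *)
Lemma sum_partial_sums : \sum_(c < n) s (n - c) = chamber_entropy.
Proof.
have -> : chamber_entropy = \sum_(j < n) (n - j.+1)%:R * v ord0 j.
  rewrite [RHS](bigID (fun j : 'I_n => (j.+1 <= n.-1)%N)) /= -[LHS]addr0;
    congr (_ + _).
  rewrite big1 // => j jn.
  have -> : (n - j.+1 = 0)%N by move: (ltn_ord j) jn; lia.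
  by rewrite mul0r.
have -> : \sum_(j < n) (n - j.+1)%:R * v ord0 j =
    \sum_(j < n) (n - j)%:R * nat_coord j.
  transitivity (\sum_(j < n) ((n - j.+1)%:R * v ord0 j + v ord0 j)).
    by rewrite big_split /= vP.1 addr0.
  apply: eq_bigr => j _; rewrite nat_coordE -[X in _ + X]mul1r -mulrDl natr1.
  by rewrite subnSK.
have sE c : s (n - c) = \sum_(j < n) (if (j < n - c)%N then nat_coord j else 0).
  by rewrite /partial_sum -big_mkcond (big_ord_widen n) ?leq_subr.
under eq_bigr => c _ do rewrite sE.
rewrite exchange_big /=; apply: eq_bigr => j _;
  rewrite -big_mkcond /= sumr_const.
rewrite mulr_natl; congr (_ *+ _).
rewrite (eq_card (B := [pred c : 'I_n | (c < n - j)%N])); last first.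
  by move=> c; rewrite !inE; have := ltn_ord j; have := ltn_ord c; lia.
rewrite -sum1_card -(big_ord_widen n (fun=> 1%N)) ?leq_subr //.
by rewrite sum_nat_const card_ord muln1.
Qed.

End Chamber.

Section Rays.
Variables (R : realType) (n : nat) (nrm : 'rV[R]_n -> R).
Hypothesis nrmP : is_norm nrm.

Lemma dist_ray_lt v x eps : dist_ray nrm v x < eps ->
  exists2 t, 0 <= t & nrm (x - t *: v) < eps.
Proof.
move=> dist_lt.
have S0 : [set nrm (x - t *: v) | t in [set t : R | 0 <= t]] !=set0.
  by exists (nrm (x - 0 *: v)), 0 => //=.
by have [_ [t t0 <-]] := inf_lt S0 dist_lt; exists t.
Qed.

Lemma dist_ray_le v x t : 0 <= t -> dist_ray nrm v x <= nrm (x - t *: v).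
Proof.
move=> t0; apply: ge_inf; last by exists t.
by exists 0 => _ [r _ <-]; apply: is_norm_ge0 nrmP _.
Qed.

End Rays.

(** * The upper bound *)
Section UpperBound.
Variables (R : realType) (n : nat) (I : choiceType) (K : I -> marked_field R n).
Variables (nrm : 'rV[R]_n -> R) (v : 'rV[R]_n).
Hypotheses (n_ge2 : (2 <= n)%N) (K_rep : representatives K).
Hypotheses (nrmP : is_norm nrm) (vP : weyl_chamber v).
Implicit Types (u : {i : I & mf_field (K i)}) (eps T : R).

Local Notation vn := (nat_coord v).
Local Notation s := (partial_sum vn).

Definition conjugate u (j : 'I_n) : R := mf_emb (K (projT1 u)) j (projT2 u).

Definition counted_units eps T : set {i : I & mf_field (K i)} :=
  [set u | [/\ unit_union u, ~ torsion_unit u,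
     nrm (log_embedding u) <= T & dist_ray nrm v (log_embedding u) < eps]].

Lemma nrm_chamber_gt0 : 0 < nrm v.
Proof.
rewrite lt_neqAle (is_norm_ge0 nrmP) andbT eq_sym;
  apply/eqP => /(is_norm_eq0 nrmP) v0.
have := vP.2 (Ordinal (ltnW n_ge2)) (Ordinal n_ge2) (ltnSn 0).
by rewrite v0 !mxE ltxx.
Qed.

Lemma unit_neq0 (F : fieldExtType rat) (x : F) : unit_group x -> x != 0.
Proof.
case=> _ [w _ xw]; apply/eqP => x0; move: xw.
by rewrite x0 mul0r => /eqP; rewrite eq_sym oner_eq0.
Qed.

Lemma conjugate_neq0 u j : unit_union u -> conjugate u j != 0.
Proof. by move=> /unit_neq0 u0; rewrite fmorph_eq0. Qed.

Section NearRay.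
Variables (C eps T : R).
Hypothesis coord_le : forall (x : 'rV[R]_n) j, `|x ord0 j| <= C * nrm x.
Hypothesis C_ge0 : 0 <= C.
Variable u : {i : I & mf_field (K i)}.
Hypothesis u_counted : counted_units eps T u.

Lemma counted_near_ray : exists t, [/\ 0 <= t, t * nrm v <= T + eps &
  forall j : 'I_n, `|ln `|conjugate u j| - t * vn j| <= C * eps].
Proof.
have [_ _ le_T /dist_ray_lt[t t0 near]] := u_counted.
exists t; split=> // [|j].
  rewrite -[t in t * _]ger0_norm // -(is_normZ nrmP).
  rewrite -[t *: v](subKr (log_embedding u)).
  apply: le_trans (is_normD nrmP _ _) _; rewrite (nrmN nrmP).
  by rewrite lerD // ltW.
have := coord_le (log_embedding u - t *: v) j; rewrite !mxE -nat_coordE.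
by move=> /le_trans; apply; rewrite ler_wpM2l // ltW.
Qed.

(** If the [i]-th conjugate were not larger than the [j]-th one, then [t * g]
    would be at most [2 * C * eps], and all the logarithms would be so small
    that the unit would be 1 or -1. *)
Lemma counted_decreasing g :
  0 < g -> (forall i j, (i < j < n)%N -> vn j <= vn i - g) ->
  C * eps * (1 + 2 * (\sum_j `|v ord0 j|) / g) < ln 2 / 2 ->
  forall i j : 'I_n, (i < j)%N -> `|conjugate u j| < `|conjugate u i|.
Proof.
move=> g_gt0 gap small i j ij; rewrite ltNge; apply/negP => le_ij.
have [u_unit nontors _ _] := u_counted.
have [t [t0 _ near]] := counted_near_ray.
have ln_le : ln `|conjugate u i| <= ln `|conjugate u j|.
  by rewrite ler_ln // posrE normr_gt0 conjugate_neq0.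
have tg : t * g <= 2 * (C * eps).
  have vij : vn j <= vn i - g by apply: gap; rewrite ij ltn_ord.
  have := near i; have := near j;
    rewrite !ler_norml => /andP[j1 j2] /andP[i1 i2].
  by have := ler_wpM2l t0 vij; lra.
have Ceps_ge0 : 0 <= C * eps by apply: le_trans (near i).
apply: nontors; apply: small_log_torsion; first by case: u_unit.
  exact: unit_neq0 u_unit.
move=> k; apply: le_lt_trans small; rewrite -/(conjugate u k).
have -> : ln `|conjugate u k| =
    (ln `|conjugate u k| - t * vn k) + t * vn k by rewrite subrK.
apply: (le_trans (ler_normD _ _)); rewrite mulrDr mulr1 lerD //.
rewrite normrM ger0_norm // !mulrA [C * eps * 2]mulrC.
rewrite mulrAC; apply: ler_pM => //; first by rewrite ler_pdivlMr.
rewrite nat_coordE (bigD1 k) //= lerDl; exact: sumr_ge0.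
Qed.

End NearRay.

(** Distinct conjugates generate, so equal conjugates give isomorphic marked
    fields; each isomorphism class has one index. *)
Lemma counted_inj (u u' : {i : I & mf_field (K i)}) :
  injective (conjugate u) -> conjugate u =1 conjugate u' -> u = u'.
Proof.
case: u u' => [i x] [i' x'] xinj xx'.
have eqi : i = i'.
  have [k [_ k_uniq]] := K_rep (K i).
  rewrite -(k_uniq i); last exact: (@conjugates_isom _ _ _ _ x x).
  by apply: k_uniq; apply: (@conjugates_isom _ _ _ _ x x') => // j;
    exact/esym/xx'.
by case: _ / eqi in x' xx' *; congr existT; apply: eq_emb => j; apply: xx'.
Qed.

Lemma counted_coef_le C eps T u : 0 <= C -> 0 <= eps ->
  (forall (x : 'rV[R]_n) j, `|x ord0 j| <= C * nrm x) ->
  counted_units eps T u -> forall k, (k <= n)%N ->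
  `|(\prod_j ('X - (conjugate u j)%:P))`_(n - k)| <=
    2 ^+ n * expR (n%:R * (C * eps)) * expR ((T + eps) / nrm v * s k).
Proof.
move=> C_ge0 eps_ge0 coord_le u_counted k kn.
have [t [t0 tT near]] := counted_near_ray coord_le C_ge0 u_counted.
have [u_unit _ _ _] := u_counted.
set eta := C * eps in near *; have eta_ge0 : 0 <= eta by rewrite mulr_ge0.
have [g g_gt0 gap] := chamber_gap vP.
pose x i := oapp (conjugate u) 0 (insub i).
pose y i := expR (t * vn i + eta).
have -> : \prod_j ('X - (conjugate u j)%:P) = \prod_(j < n) ('X - (x j)%:P).
  by apply: eq_bigr => j _; rewrite /x valK.
apply: le_trans (coef_prod_XsubC_le (y := y) _ _ _ kn) _.
- by move=> j; exact: expR_ge0.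
- move=> j jn; rewrite /x insubT /=.
  rewrite -[X in X <= _]lnK ?posrE ?normr_gt0 ?conjugate_neq0 //.
  rewrite ler_expR; have := near (Ordinal jn); rewrite ler_norml /=.
  by move=> /andP[_]; rewrite lerBlDl.
- move=> i j /andP[]; rewrite leq_eqVlt => /orP[/eqP->//|ij] jn.
  rewrite ler_expR lerD2r ler_wpM2l //.
  by have := gap i j; rewrite ij jn => /(_ isT); lra.
rewrite -mulrA ler_wpM2l ?exprn_ge0 // -expR_sum -expRD ler_expR.
rewrite big_split /= -mulr_sumr -/(partial_sum vn k) sumr_const card_ord.
rewrite -[eta *+ k]mulr_natl [leLHS]addrC lerD //.
  by rewrite ler_wpM2r // ler_nat.
rewrite ler_wpM2r ?(partial_sum_ge0 vP) // ler_pdivlMr //.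
exact: nrm_chamber_gt0.
Qed.

(** A counted unit is encoded by the [n] lower coefficients of its polynomial.
    The one of index [c] is an integer of absolute value at most [B c], hence
    takes at most [3 * B c] values. *)
Lemma unit_count_le : exists2 eps0, 0 < eps0 & forall eps, 0 < eps < eps0 ->
  exists2 A, 0 < A & forall T, 0 <= T ->
  (unit_count K nrm eps T v <=
    (A * expR (T * (chamber_entropy v / nrm v)))%:E)%E.
Proof.
have [C C_gt0 coord_le] := coord_le_nrm nrmP; have C_ge0 := ltW C_gt0.
have [g g_gt0 gap] := chamber_gap vP.
pose V := 1 + 2 * (\sum_j `|v ord0 j|) / g.
have V_gt0 : 0 < V.
  by rewrite ltr_pwDl // divr_ge0 ?(ltW g_gt0) // mulr_ge0 // sumr_ge0.
exists (ln 2 / 2 / V / C); first by rewrite !divr_gt0 // ln_gt0 // ltr1n.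
move=> eps /andP[eps_gt0]; rewrite ltr_pdivlMr // ltr_pdivlMr // => small.
rewrite [eps * C]mulrC in small; have eps_ge0 := ltW eps_gt0.
pose a := 2 ^+ n * expR (n%:R * (C * eps)).
have a_ge1 : 1 <= a.
  rewrite mulr_ege1 ?exprn_ege1 ?ler1n // -expR0 ler_expR !mulr_ge0 //.
exists ((3 * a) ^+ n * expR (eps * (chamber_entropy v / nrm v))).
  by rewrite mulr_gt0 ?expR_gt0 // exprn_gt0 // mulr_gt0 // (lt_le_trans ltr01).
move=> T T_ge0; pose tau := (T + eps) / nrm v.
have tau_ge0 : 0 <= tau by rewrite divr_ge0 ?addr_ge0 // ltW // nrm_chamber_gt0.
pose B (c : 'I_n) := a * expR (tau * s (n - c)).
(* The integers between [- b c] and [b c], shifted by [b c], are the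
   elements of ['I_(b c).*2.+1]. *)
pose b c := Num.truncn (B c).
have B_ge1 c : 1 <= B c.
  rewrite mulr_ege1 // -expR0 ler_expR mulr_ge0 //.
  by apply: (partial_sum_ge0 vP); rewrite leq_subr.
have decr u : counted_units eps T u ->
    forall i j : 'I_n, (i < j)%N -> `|conjugate u j| < `|conjugate u i|.
  move=> u_counted.
  exact: (counted_decreasing coord_le C_ge0 u_counted g_gt0 gap).
have conj_inj u : counted_units eps T u -> injective (conjugate u).
  by move=> /decr u_dec i j xij; apply: (decreasing_injective u_dec);
    rewrite xij.
pose code u (f : {dffun forall c : 'I_n, 'I_(b c).*2.+1}) := forall c : 'I_n,
  (\prod_j ('X - (conjugate u j)%:P))`_c = ((f c)%:Z - (b c)%:Z)%:~R.
rewrite -[unit_count _ _ _ _ _]/(counting (counted_units eps T)).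
apply: (@le_trans _ _ (#|{dffun forall c : 'I_n, 'I_(b c).*2.+1}|%:R)%:E%E).
  apply: (@counting_le_card _ _ _ _ code) => [u u_counted|u u' f uc uc' uf u'f].
    have [[u_int _] _ _ _] := u_counted.
    have [p _ pE] := distinct_conjugates_prod u_int (conj_inj u u_counted).
    have {}pE : map_poly intr p = \prod_j ('X - (conjugate u j)%:P) := pE.
    have coef_le (c : 'I_n) : (absz (p`_c)%R <= b c)%N.
      rewrite truncn_ge_nat ?(le_trans ler01) // natr_absz intr_norm.
      rewrite -coef_map pE.
      have := counted_coef_le C_ge0 eps_ge0 coord_le u_counted (leq_subr c n).
      by rewrite subKn // ltnW.
    exists (finfun (fun c : 'I_n => inord (absz (p`_c + (b c)%:Z)))) => c.
    rewrite -pE coef_map ffunE inordK; last by have := coef_le c; lia.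
    by congr intmul; have := coef_le c; move: (b c) (p`_c) => bc pc; lia.
  apply: counted_inj; first exact: conj_inj.
  apply: eq_decreasing_roots; try exact: decr.
  apply/polyP => c; have [c_lt|c_gt|->] := ltngtP c n.
  - by rewrite (uf (Ordinal c_lt)) (u'f (Ordinal c_lt)).
  - by rewrite !nth_default // size_prod_XsubC_ord.
  - have mon w : (\prod_j ('X - (conjugate w j)%:P))`_n = 1.
      have /monicP := monic_prod_XsubC (index_enum 'I_n) xpredT (conjugate w).
      by rewrite lead_coefE size_prod_XsubC_ord.
    by rewrite !mon.
rewrite lee_fin card_dep_ffun foldrE big_map big_enum /= natr_prod.
apply: (@le_trans _ _ (\prod_(c < n) (3 * B c))).
  apply: ler_prod => c _; rewrite ler0n card_ord -natr1 -muln2 natrM.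
  have : (b c)%:R <= B c by rewrite truncn_le (le_trans ler01).
  by have := B_ge1 c; lra.
rewrite /B; under eq_bigr => c _ do rewrite mulrA.
rewrite big_split /= prodr_const card_ord -expR_sum -mulr_sumr sum_partial_sums
  //.
rewrite -[leRHS]mulrA ler_pM2l;
  last by rewrite exprn_gt0 // mulr_gt0 // (lt_le_trans ltr01).
by rewrite -expRD ler_expR /tau; lra.
Qed.

End UpperBound.

(** * The lower bound *)
Lemma expR_mul_ge (R : realType) (x a t : R) :
  0 < a -> x / a <= t -> x <= expR (t * a).
Proof.
move=> a_gt0; rewrite ler_pdivrMr // => /le_trans; apply.
by apply: le_trans (expR_ge1Dx _); rewrite lerDr.
Qed.

Section LowerBound.
Variables (R : realType) (n : nat) (I : choiceType) (K : I -> marked_field R n).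
Variables (nrm : 'rV[R]_n -> R) (v : 'rV[R]_n).
Hypotheses (n_ge2 : (2 <= n)%N) (K_rep : representatives K).
Hypotheses (nrmP : is_norm nrm) (vP : weyl_chamber v).
Implicit Types (u : {i : I & mf_field (K i)}) (eps T : R).

Local Notation vn := (nat_coord v).
Local Notation s := (partial_sum vn).

(** The field provided by [marked_field_of_roots] is isomorphic to one of the
    representatives, to which the root is transported. *)
Lemma unit_of_poly (p : {poly int}) (x : 'I_n -> R) :
  p \is monic -> p`_0 * p`_0 = 1 -> injective x ->
  irreducible_poly (map_poly intr p : {poly rat}) ->
  map_poly intr p = \prod_j ('X - (x j)%:P) ->
  exists u, unit_union u /\ conjugate u =1 x.
Proof.
move=> mp p0 xinj p_irr pE.
have [M [z pz zE]] := marked_field_of_roots xinj p_irr pE.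
have [i [[phi _ phiE] _]] := K_rep M.
exists (existT _ i (phi z)); split=> [|j];
  last by rewrite /conjugate /= phiE zE.
apply: (unit_group_root mp p0) => /=.
by rewrite -(map_poly_intr phi) fmorph_root.
Qed.

Lemma conjugates_counted C eta t eps T u :
  (forall (x : 'rV[R]_n) a, 0 <= a -> (forall j, `|x ord0 j| <= a) ->
    nrm x <= C * a) ->
  0 <= eta -> C * eta < eps -> 0 <= t -> t * nrm v <= T - eps ->
  unit_union u -> injective (conjugate u) ->
  (forall j : 'I_n, expR (t * vn j - eta) <= conjugate u j <=
    expR (t * vn j + eta)) ->
  counted_units nrm v eps T u.
Proof.
move=> nrm_le eta_ge0 C_eps t_ge0 tT u_unit u_inj u_bd.
have near : nrm (log_embedding u - t *: v) < eps.
  apply: le_lt_trans C_eps; apply: nrm_le => // j; rewrite !mxE -nat_coordE.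
  rewrite -/(conjugate u j); have /andP[lo hi] := u_bd j.
  have x_gt0 : 0 < conjugate u j by apply: lt_le_trans lo; exact: expR_gt0.
  rewrite [`|conjugate u j|]ger0_norm ?(ltW x_gt0) // ler_norml.
  move: lo hi; rewrite -{1 2}[conjugate u j]lnK // !ler_expR => lo hi.
  by apply/andP; split; lra.
split=> //.
- move=> tors; have : Ordinal (ltnW n_ge2) = Ordinal n_ge2 :> 'I_n.
    apply: u_inj; rewrite /conjugate.
    by case: tors => ->; rewrite ?rmorphN ?rmorph1.
  by move/(congr1 val).
- rewrite -[log_embedding u](subrK (t *: v));
    apply: le_trans (is_normD nrmP _ _) _.
  by rewrite (is_normZ nrmP) ger0_norm //; move: near tT; lra.
- exact: le_lt_trans (dist_ray_le nrmP _ _ t_ge0) near.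
Qed.

Lemma sum_partial_sumsS : \sum_(c < n.-1) s c.+1 = chamber_entropy v.
Proof.
rewrite -(sum_partial_sums vP) [RHS](reindex_inj rev_ord_inj) /=.
have -> : \sum_(j < n) s (n - (n - j.+1)) = \sum_(j < n) s j.+1.
  by apply: eq_bigr => j _; rewrite subKn.
have n_gt0 : (0 < n)%N by exact: ltnW.
have sn : s n.-1.+1 = 0 by rewrite prednK // (partial_sum_full vP).
rewrite -!(big_mkord xpredT (fun j => s j.+1)) -[LHS]addr0 -{2}sn.
by rewrite -(big_nat_recr _ _ (fun j => s j.+1)) //= prednK.
Qed.

(** For a large [t], a family of units indexed by the integral parameters [f c],
    the coefficient of index [k = c + 1] being determined by
    [m_k = 'C(n, k) + 4 * (start k + f c)], plus 2 if [k = n - 1]. The term with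
    [start k] brings [m_k] above [expR (t * s k)], and [width] leaves it below
    [(1 + delta) * expR (t * s k)]. *)
Section Family.
Variables (t g eta delta eps T C D : R).
Hypotheses (t_ge0 : 0 <= t) (eta_gt0 : 0 < eta) (delta_gt0 : 0 < delta).
Hypothesis g_gt0 : 0 < g.
Hypothesis gap : forall i j, (i < j < n)%N -> vn j <= vn i - g.
Hypothesis eta_small : 2 * eta < t * g.
Hypothesis dominated :
  (1 + delta) * (expR (- eta) + n%:R * expR (- (t * g - n%:R * eta))) < 1.
Hypothesis nrm_le : forall (x : 'rV[R]_n) a,
  0 <= a -> (forall j, `|x ord0 j| <= a) -> nrm x <= C * a.
Hypotheses (C_eps : C * eta < eps) (tT : t * nrm v <= T - eps).
Hypothesis bin_le : forall k, 'C(n, k)%:R <= D.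
Hypothesis t_large : forall k, (0 < k < n)%N ->
  D + 16 <= delta / 2 * expR (t * s k).

Let start k := (Num.truncn (expR (t * s k) / 4)).+1.
Let width c := Num.truncn (delta * expR (t * s c.+1) / 8).
Let params : finType := {dffun forall c : 'I_n.-1, 'I_(width c)}.

(** The polynomial is [(X - 1)^n + 2 h], and these are the absolute values of
    the coefficients of [h]: the only odd one is at [k = n - 1], and the outer
    ones vanish, so that [m_0 = m_n = 1]. *)
Let half_coeff (f : params) k : nat :=
  if insub k.-1 is Some c then (if (0 < k)%N then
    2 * (start k + f c) + (k == n.-1) else 0)%N else 0%N.

Let half_coeff0 f : half_coeff f 0 = 0%N.
Proof. by rewrite /half_coeff; case: insub. Qed.

Let half_coeffn f : half_coeff f n = 0%N.
Proof. by rewrite /half_coeff insubF // ltnn. Qed.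

Let half_coeffE f (c : 'I_n.-1) :
  half_coeff f c.+1 = (2 * (start c.+1 + f c) + (c.+1 == n.-1))%N.
Proof. by rewrite /half_coeff /= valK. Qed.

Let coeff (f : params) k : int := 'C(n, k)%:Z + 2 * (half_coeff f k)%:Z.

Let coeff0 f : coeff f 0 = 1.
Proof. by rewrite /coeff half_coeff0 bin0. Qed.

Let coeffn f : coeff f n = 1.
Proof. by rewrite /coeff half_coeffn binn. Qed.

Let coeff_bounds f k : (k <= n)%N ->
  expR (t * s k) <= (coeff f k)%:~R <= (1 + delta) * expR (t * s k).
Proof.
have delta_ge0 := ltW delta_gt0.
rewrite leq_eqVlt => /orP[/eqP->|kn].
  by rewrite coeffn (partial_sum_full vP) mulr0 expR0 lexx mulr1 lerDl.
case: k kn => [|k] kn.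
  by rewrite coeff0 /partial_sum big_ord0 mulr0 expR0 lexx mulr1 lerDl.
have kn1 : (k < n.-1)%N by rewrite -ltnS prednK // ltnW.
have -> : (coeff f k.+1)%:~R = 'C(n, k.+1)%:R +
    4 * ((start k.+1)%:R + (f (Ordinal kn1))%:R) + 2 * (k.+1 == n.-1)%:R :> R.
  rewrite /coeff (half_coeffE f (Ordinal kn1)).
  by rewrite intrD intrM -!pmulrn !(natrD, natrM) /=; ring.
set e := expR _; have e_gt0 : 0 < e by exact: expR_gt0.
have /andP[base_lo base_hi] : (start k.+1)%:R - 1 <= e / 4 < (start k.+1)%:R.
  rewrite -[(start k.+1)%:R]/((Num.truncn (e / 4)).+1%:R) mulrSr addrK -mulrSr.
  exact: truncn_itv (divr_ge0 (ltW e_gt0) (ler0n _ 4)).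
have f_le : (f (Ordinal kn1))%:R <= delta * e / 8.
  apply: (@le_trans _ _ (width k)%:R); first by rewrite ler_nat ltnW.
  by rewrite truncn_le divr_ge0 // mulr_ge0 // ltW.
have := t_large (k := k.+1); rewrite /= kn => /(_ isT); rewrite -/e => large.
have bin_ge0 : 0 <= 'C(n, k.+1)%:R :> R by exact: ler0n.
have f_ge0 : 0 <= (f (Ordinal kn1))%:R :> R by exact: ler0n.
have b_ge0 : 0 <= (k.+1 == n.-1)%:R :> R by exact: ler0n.
have b_le1 : (k.+1 == n.-1)%:R <= 1 :> R by case: eqP.
have := bin_le k.+1.
by move=> bl; apply/andP; split; lra.
Qed.

Let poly_of f : {poly int} := alt_poly n (coeff f).

Let poly_of_monic f : poly_of f \is monic.
Proof. exact: (alt_poly_monic n (coeff0 f)).1. Qed.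

Let poly_of_unit f : (poly_of f)`_0 * (poly_of f)`_0 = 1.
Proof.
have := coef_alt_poly (coeff f) (leqnn n); rewrite subnn coeffn mulr1 => ->.
by rewrite -expr2 sqrr_sign.
Qed.

Let poly_of_irreducible f :
  irreducible_poly (map_poly intr (poly_of f) : {poly rat}).
Proof.
apply: alt_poly_irreducible; rewrite ?half_coeff0 //; first exact: ltnW.
have n1E : n.-1 = n.-2.+1 by rewrite prednK // -ltnS prednK // ltnW.
have n2_lt : (n.-2 < n.-1)%N by rewrite n1E.
rewrite (bigD1 (inord n.-1)) //= inordK; last by rewrite ltnS leq_pred.
rewrite rpredDr; last first.
  apply: rpred_sum => k; rewrite -val_eqE /= inordK ?ltnS ?leq_pred // => kn1.
  apply: dvdz_mull; rewrite /half_coeff; case: insubP => // c _ _;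
    case: ifP => // _.
  by rewrite (negPf kn1) addn0 PoszM dvdz_mulr.
have := half_coeffE f (Ordinal n2_lt); rewrite /= -n1E eqxx => ->.
by rewrite dvdzE abszMsign /= dvdn2 oddD oddM.
Qed.

Let unit_of f : {u : {i : I & mf_field (K i)} | counted_units nrm v eps T u /\
  map_poly intr (poly_of f) = \prod_j ('X - (conjugate u j)%:P) :> {poly R}}.
Proof.
apply: cid.
have m0 : (fun k => (coeff f k)%:~R : R) 0%N = 1 by rewrite coeff0.
have [x [xinj xE x_bd]] :=
  alt_poly_roots (ltW g_gt0) gap t_ge0 eta_gt0 (ltW delta_gt0)
  eta_small dominated m0 (coeff_bounds f).
have pE : map_poly intr (poly_of f) = \prod_j ('X - (x j)%:P) :> {poly R}.
  by rewrite map_alt_poly -xE.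
have [u [u_unit ux]] :=
  unit_of_poly (poly_of_monic f) (poly_of_unit f) xinj
    (poly_of_irreducible f) pE.
exists u; split; last by rewrite pE; apply: eq_bigr => j _; rewrite ux.
apply: (conjugates_counted nrm_le (ltW eta_gt0) C_eps t_ge0 tT) => // [|j].
  by move=> i j; rewrite !ux; exact: xinj.
by rewrite ux.
Qed.

Let unit_of_inj : injective (fun f => sval (unit_of f)).
Proof.
move=> f f' /= ff'; have [_ fE] := svalP (unit_of f);
  have [_ f'E] := svalP (unit_of f').
rewrite ff' -f'E in fE.
have {}fE : poly_of f = poly_of f' by apply: (map_inj_poly _ _ fE) => //;
  exact: intr_inj.
apply/ffunP => c; apply/val_inj => /=.
have c1n : (c.+1 <= n)%N by have := ltn_ord c; lia.
have := congr1 (fun p : {poly int} => p`_(n - c.+1)) fE.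
rewrite /= !coef_alt_poly // => /mulfI; rewrite signr_eq0 => /(_ isT).
rewrite /coeff !half_coeffE => /addrI/(@mulfI int 2 isT)/eqP.
by rewrite eqz_nat eqn_add2r eqn_pmul2l // eqn_add2l => /eqP.
Qed.

Lemma unit_count_family :
  (((delta / 16) ^+ n.-1 * expR (t * chamber_entropy v))%:E <=
   unit_count K nrm eps T v)%E.
Proof.
rewrite -[unit_count _ _ _ _ _]/(counting (counted_units nrm v eps T)).
apply: le_trans (card_le_counting R unit_of_inj (fun f =>
  (svalP (unit_of f)).1)).
rewrite lee_fin card_dep_ffun foldrE big_map big_enum /= natr_prod.
rewrite -sum_partial_sumsS mulr_sumr expR_sum -[in _ ^+ _](card_ord n.-1)
  -prodr_const.
rewrite -big_split /=; apply: ler_prod => c _; rewrite card_ord.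
have cn : (0 < c.+1 < n)%N by have := ltn_ord c; lia.
have := t_large cn; have D_ge0 : 0 <= D := le_trans (ler0n _ _) (bin_le 0).
set e := expR _ => e_large; have e_ge0 : 0 <= e by exact: expR_ge0.
have -> /= : 0 <= delta / 16 * e by rewrite mulr_ge0 // divr_ge0 // ltW.
have := truncnS_gt (delta * e / 8).
by rewrite -[(Num.truncn _).+1%:R]natr1 -[Num.truncn _]/(width c); lra.
Qed.

End Family.

(** The precision [eta] on the logarithms is fixed by [eps], then [delta] is
    chosen with [(1 + delta) * expR (- eta) < 1], which leaves the margin [gain]
    for the monomials that do not compete; they are beaten once [t] is large. *)
Lemma unit_count_ge eps : 0 < eps ->
  exists2 c, 0 < c & exists T0, forall T, T0 <= T ->
  ((c * expR (T * (chamber_entropy v / nrm v)))%:E <=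
    unit_count K nrm eps T v)%E.
Proof.
move=> eps_gt0; have N_gt0 := nrm_chamber_gt0 n_ge2 nrmP vP.
have [C C_gt0 nrm_le] := nrm_le_coord nrmP.
have [g g_gt0 gap] := chamber_gap vP.
have n_gt0 : 0 < n%:R :> R by rewrite ltr0n ltnW.
pose eta := eps / (2 * C).
have eta_gt0 : 0 < eta by rewrite divr_gt0 // mulr_gt0.
have C_eps : C * eta < eps.
  have -> : C * eta = eps / 2 by rewrite /eta; field; rewrite gt_eqF.
  by lra.
pose delta := expR (eta / 2) - 1.
have delta_gt0 : 0 < delta by rewrite subr_gt0 expR_gt1 divr_gt0.
pose D : R := \sum_(k < n.+1) 'C(n, k)%:R.
have D_ge0 : 0 <= D by apply: sumr_ge0.
have bin_le k : 'C(n, k)%:R <= D.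
  have [kn|nk] := ltnP k n.+1; last by rewrite bin_small.
  by rewrite /D (bigD1 (Ordinal kn)) //= lerDl sumr_ge0.
pose gain := expR (- (eta / 2)) - expR (- eta).
have gain_gt0 : 0 < gain by rewrite subr_gt0 ltr_expR; lra.
pose t1 := (n%:R * expR (n%:R * eta) + 1) / gain.
pose t2 := (D + 16) / (delta / 2).
pose t0 := Num.max (Num.max 0 (2 * eta / g + 1))
                   (Num.max (t1 / g) (t2 / (g / n%:R))).
exists ((delta / 16) ^+ n.-1 * expR (- eps * (chamber_entropy v / nrm v))).
  by rewrite mulr_gt0 ?expR_gt0 // exprn_gt0 // divr_gt0.
exists (t0 * nrm v + eps) => T T_large; pose t := (T - eps) / nrm v.
have : t0 <= t by rewrite ler_pdivlMr // lerBrDr.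
rewrite !ge_max => /andP[/andP[t_ge0 t_eta] /andP[t_dom t_bin]].
have tT : t * nrm v <= T - eps by rewrite divfK ?gt_eqF.
have eta_small : 2 * eta < t * g.
  by rewrite -ltr_pdivrMr //; apply: lt_le_trans t_eta; rewrite ltrDl.
have dominated :
    (1 + delta) * (expR (- eta) + n%:R * expR (- (t * g - n%:R * eta))) < 1.
  have -> : 1 + delta = (expR (- (eta / 2)))^-1.
    by rewrite -expRN opprK /delta; ring.
  rewrite mulrC ltr_pdivrMr ?expR_gt0 // mul1r -ltrBrDl -/gain.
  have -> : - (t * g - n%:R * eta) = n%:R * eta - t * g by ring.
  rewrite expRD expRN mulrA ltr_pdivrMr ?expR_gt0 // -ltr_pdivrMl // mulrC.
  apply: lt_le_trans (expR_mul_ge g_gt0 t_dom).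
  by rewrite ltr_pM2r ?invr_gt0 // ltrDl.
have t_large k : (0 < k < n)%N -> D + 16 <= delta / 2 * expR (t * s k).
  move=> kn; rewrite mulrC -ler_pdivrMr ?divr_gt0 //.
  apply: (le_trans (expR_mul_ge _ t_bin)); first by rewrite divr_gt0.
  by rewrite ler_expR ler_wpM2l // (partial_sum_ge vP).
apply: le_trans (unit_count_family t_ge0 eta_gt0 delta_gt0 g_gt0 gap eta_small
  dominated nrm_le C_eps tT bin_le t_large).
rewrite lee_fin -mulrA ler_pM2l ?exprn_gt0 ?divr_gt0 // -expRD ler_expR /t.
by lra.
Qed.

End LowerBound.

(** * Growth rates *)
Section LimSup.
Variable R : realType.

Lemma limf_esup_near (F : set_system R) (h : R -> \bar R) (kappa : R) :
  ProperFilter F ->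
  (forall e, 0 < e -> \forall T \near F,
     ((kappa - e)%:E <= h T <= (kappa + e)%:E)%E) ->
  limf_esup h F = kappa%:E.
Proof.
move=> FF near_kappa; rewrite limf_esupE; apply/eqP; rewrite eq_le; apply/andP;
  split.
  apply/lee_addgt0Pr => e e_gt0; rewrite -EFinD.
  pose V := [set T | ((kappa - e)%:E <= h T <= (kappa + e)%:E)%E].
  apply: (@le_trans _ _ (ereal_sup (h @` V))).
    by apply: ereal_inf_lbound; exists V => //; exact: near_kappa.
  by apply: ge_ereal_sup => _ [T /andP[_ ?] <-].
apply: le_ereal_inf_tmp => _ [V FV <-]; apply/lee_addgt0Pr => e e_gt0.
have [T [VT /andP[lo _]]] := filter_ex (filterI FV (near_kappa e e_gt0)).
rewrite -leeBlDr // -EFinB; apply: le_trans lo _.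
by apply: ereal_sup_ubound; exists T.
Qed.

Lemma limf_einf_near (F : set_system R) (h : R -> \bar R) (kappa : R) :
  ProperFilter F ->
  (forall e, 0 < e -> \forall T \near F,
     ((kappa - e)%:E <= h T <= (kappa + e)%:E)%E) ->
  limf_einf h F = kappa%:E.
Proof.
move=> FF near_kappa; rewrite /limf_einf.
rewrite (@limf_esup_near _ _ (- kappa)) ?EFinN ?oppeK //.
move=> e e_gt0; apply: filterS (near_kappa e e_gt0) => T /andP[lo hi].
by rewrite leeNl leeNr -!EFinN !opprD !opprK hi.
Qed.

(** The logarithms of the constants [a] and [b] are negligible against [T]. *)
Lemma exponential_growth (f : R -> \bar R) (kappa a b T0 : R) :
  0 < a -> 0 < b ->
  (forall T, T0 <= T ->
     ((a * expR (T * kappa))%:E <= f T <= (b * expR (T * kappa))%:E)%E) ->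
  forall e, 0 < e -> \forall T \near pinfty_nbhs R,
    ((kappa - e)%:E <= (T^-1)%:E * lne (f T) <= (kappa + e)%:E)%E.
Proof.
move=> a_gt0 b_gt0 f_bd e e_gt0.
pose c := `|ln a| + `|ln b|.
pose T1 := Num.max T0 (Num.max 1 (c / e)).
have := nbhs_pinfty_ge (num_real T1); apply: filterS => T.
rewrite /= !ge_max => /and3P[T_T0 T_ge1 T_c].
have T_gt0 : 0 < T := lt_le_trans ltr01 T_ge1.
have := f_bd T T_T0; case: (f T) => [x| |]; rewrite ?leye_eq ?andbF //=.
rewrite !lee_fin => /andP[lo hi].
have x_gt0 : 0 < x by apply: lt_le_trans lo; rewrite mulr_gt0 ?expR_gt0.
rewrite [x <= 0]leNgt x_gt0 /= -EFinM !lee_fin.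
have lnE y : 0 < y -> ln (y * expR (T * kappa)) = ln y + T * kappa.
  by move=> y_gt0; rewrite lnM ?posrE ?expR_gt0 // expRK.
have lo' : ln a + T * kappa <= ln x.
  by rewrite -lnE // ler_ln // posrE mulr_gt0 ?expR_gt0.
have hi' : ln x <= ln b + T * kappa.
  by rewrite -lnE // ler_ln // posrE mulr_gt0 ?expR_gt0.
have cT : c <= T * e by rewrite -ler_pdivrMr.
have := ler_norm (- ln a); have := ler_norm (ln b); rewrite normrN => lb la.
have := normr_ge0 (ln a); have := normr_ge0 (ln b) => nb na.
rewrite ler_pdivlMl // ler_pdivrMl //.
by move: cT; rewrite /c => cT; apply/andP; split; lra.
Qed.

End LimSup.

Theorem theorem1p3 (R : realType) (n : nat)
    (I : choiceType) (K : I -> marked_field R n)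
    (nrm : 'rV[R]_n -> R) (v : 'rV[R]_n) :
  (2 <= n)%N -> representatives K -> is_norm nrm -> weyl_chamber v ->
  (* [j : 'I_n] is the index [i = j.+1] of the paper *)
  let entropy := \sum_(j < n | (j.+1 <= n.-1)%N) (n - j.+1)%:R * v ord0 j in
  upper_entropy K nrm v = entropy%:E /\ lower_entropy K nrm v = entropy%:E.
Proof.
move=> n_ge2 K_rep nrmP vP entropy; rewrite -[entropy]/(chamber_entropy v).
have N_gt0 := nrm_chamber_gt0 n_ge2 nrmP vP.
pose kappa := chamber_entropy v / nrm v.
have entropyE : (chamber_entropy v)%:E = ((nrm v)%:E * kappa%:E)%E.
  by rewrite -EFinM mulrC divfK ?gt_eqF.
have [eps0 eps0_gt0 count_le] := unit_count_le n_ge2 K_rep nrmP vP.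
have growth eps : 0 < eps < eps0 -> forall e, 0 < e ->
  \forall T \near pinfty_nbhs R,
    ((kappa - e)%:E <= (T^-1)%:E * lne (unit_count K nrm eps T v) <=
      (kappa + e)%:E)%E.
  move=> eps_in; have /andP[eps_gt0 _] := eps_in.
  have [b b_gt0 le_b] := count_le eps eps_in.
  have [a a_gt0 [T0 ge_a]] := unit_count_ge n_ge2 K_rep nrmP vP eps_gt0.
  apply: (@exponential_growth _ _ kappa a b (Num.max T0 0)) => // T.
  by rewrite ge_max => /andP[T_T0 T_ge0]; rewrite ge_a // le_b.
have lim_kappa (g : R -> \bar R) :
    (forall eps, 0 < eps < eps0 -> g eps = kappa%:E) ->
      lim (g @ (0 : R)^'+) = kappa%:E.
  move=> gE; apply: cvg_lim => //; apply: cvg_near_cst.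
  near=> eps; apply: gE; apply/andP; split; near: eps.
    exact: nbhs_right_gt.
  exact: nbhs_right_lt.
by rewrite entropyE; split; congr (_ * _)%E;
  apply: lim_kappa => eps /growth near_kappa;
  [apply: limf_esup_near | apply: limf_einf_near].
Unshelve. all: by end_near. Qed.
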